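(* Let $G$ be a finite group, let $F$ be an algebraically closed field of characteristic $p>0$, and let $B$ be a block of $FG$ with non-abelian defect group $D$ of order $p^d$. Then one of the following holds: (i) $LL(ZB)<3p^{d-2}$; (ii) $p\ge 5$, $D\cong W_{p^d}$ and $LL(ZB)<4p^{d-2}$. In any case, $LL(ZB)<\min\{p^{d-1},4p^{d-2}\}$.
   Context: A block $B$ of $FG$ is an indecomposable two-sided ideal direct summand of the group algebra $FG$, with block idempotent $1_B$; $ZB$ is its center, a commutative finite-dimensional local $F$-algebra. Defect groups of $B$ are in the usual sense of modular representation theory. For a finite-dimensional $F$-algebra $A$ with Jacobson radical $J(A)$, the Loewy length $LL(A)$ is the smallest integer $n\ge 0$ with $J(A)^n=0$. For $d\ge 3$, $W_{p^d}$ denotes the group of order $p^d$ $$W_{p^d}:=\langle x,y,z\mid x^{p^{d-2}}=y^p=z^p=[x,y]=[x,z]=1,\ [y,z]=x^{p^{d-3}}\rangle,$$ a central product of a cyclic group $C_{p^{d-2}}$ and an extraspecial group of order $p^3$. *)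

(* Defs.v *)
From HB Require Import structures.
From mathcomp Require Import all_boot all_order all_algebra all_fingroup.
From mathcomp Require Import all_solvable all_field.
From mathcomp Require Import boolp.

Set Implicit Arguments.
Unset Strict Implicit.
Unset Printing Implicit Defensive.

Import GroupScope GRing.Theory.

Local Open Scope ring_scope.

(* The alias hides the pointwise product that ssralg puts on {ffun aT -> R};
   only the F-space structure is inherited, and the product is convolution.   *)
Definition galg (F : fieldType) (gT : finGroupType) := {ffun gT -> F^o}.

HB.instance Definition _ (F : fieldType) (gT : finGroupType) :=
  Vector.copy (galg F gT) {ffun gT -> F^o}.

Section GroupAlgebra.

Variables (F : fieldType) (gT : finGroupType).
Implicit Types (a b c : galg F gT) (g x y : gT).

Definition gelt g : galg F gT := [ffun x => (x == g)%:R].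

Definition galg_mul a b : galg F gT :=
  [ffun x => \sum_y (a y : F) * (b (y^-1 * x)%g : F)].

Lemma galg_mulA : associative galg_mul.
Proof.
move=> a b c; apply/ffunP=> x; rewrite !ffunE.
under eq_bigr => y _ do rewrite ffunE big_distrr /=.
under [RHS]eq_bigr => y _ do rewrite ffunE big_distrl /=.
rewrite [RHS]exchange_big /=; apply: eq_bigr => y _.
rewrite [RHS](reindex_inj (mulgI y)) /=; apply: eq_bigr => z _.
by rewrite mulrA mulKg invMg mulgA.
Qed.

Lemma galg_mul1l : left_id (gelt 1) galg_mul.
Proof.
move=> a; apply/ffunP=> x; rewrite ffunE (bigD1 1%g) //= ffunE eqxx mul1r.
rewrite invg1 mul1g big1 ?addr0 // => y /negPf ne_y1.
by rewrite ffunE ne_y1 mul0r.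
Qed.

Lemma galg_mul1r : right_id (gelt 1) galg_mul.
Proof.
move=> a; apply/ffunP=> x; rewrite ffunE (bigD1 x) //= ffunE mulVg eqxx mulr1.
rewrite big1 ?addr0 // => y ne_yx.
by rewrite ffunE -eq_mulVg1 (negPf ne_yx) mulr0.
Qed.

Lemma galg_mulDl : left_distributive galg_mul +%R.
Proof.
move=> a b c; apply/ffunP=> x; rewrite !ffunE -big_split /=.
by apply: eq_bigr => y _; rewrite ffunE mulrDl.
Qed.

Lemma galg_mulDr : right_distributive galg_mul +%R.
Proof.
move=> a b c; apply/ffunP=> x; rewrite !ffunE -big_split /=.
by apply: eq_bigr => y _; rewrite ffunE mulrDr.
Qed.

Lemma galg_1_neq0 : gelt 1 != 0.
Proof.
apply/eqP=> /ffunP/(_ 1%g); rewrite !ffunE eqxx => /eqP.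
by rewrite oner_eq0.
Qed.

HB.instance Definition _ := GRing.Zmodule_isNzRing.Build (galg F gT)
  galg_mulA galg_mul1l galg_mul1r galg_mulDl galg_mulDr galg_1_neq0.

Lemma galg_scaleAl (k : F) a b : k *: (a * b) = (k *: a) * b.
Proof.
apply/ffunP=> x; rewrite !ffunE scaler_sumr.
by apply: eq_bigr => y _; rewrite ffunE; apply: mulrA.
Qed.

HB.instance Definition _ := GRing.Lmodule_isLalgebra.Build F (galg F gT)
  galg_scaleAl.

Lemma galg_scaleAr (k : F) a b : k *: (a * b) = a * (k *: b).
Proof.
apply/ffunP=> x; rewrite !ffunE scaler_sumr.
by apply: eq_bigr => y _; rewrite ffunE; apply: mulrCA.
Qed.

HB.instance Definition _ := GRing.Lalgebra_isAlgebra.Build F (galg F gT)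
  galg_scaleAr.

HB.instance Definition _ := Algebra_isFalgebra.Build F (galg F gT).

Lemma galg_mulE a b x : (a * b) x = \sum_y (a y : F) * (b (y^-1 * x)%g : F).
Proof. exact: ffunE. Qed.

Lemma geltM g h : gelt (g * h)%g = gelt g * gelt h.
Proof.
apply/ffunP=> x; rewrite galg_mulE (bigD1 g) //= !ffunE eqxx mul1r.
rewrite big1 ?addr0 => [|y /negPf ne_yg]; last by rewrite ffunE ne_yg mul0r.
by rewrite -[x in LHS](mulKVg g) (inj_eq (mulgI g)).
Qed.

End GroupAlgebra.

Section Algebra.

Variables (F : fieldType) (A : falgType F).
Implicit Types (x y : A) (U V M : {vspace A}).

Definition left_ideal U := (fullv * U <= U)%VS.
Definition right_ideal U := (U * fullv <= U)%VS.
Definition two_sided_ideal U := left_ideal U && right_ideal U.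

Definition maximal_left_ideal M : Prop :=
  [/\ left_ideal M, M != fullv
    & forall U, left_ideal U -> (M <= U)%VS -> U = M \/ U = fullv].

Lemma dim_min_ex (P : {vspace A} -> Prop) :
  (exists U, P U) -> exists U, P U /\ forall V, P V -> (\dim U <= \dim V)%N.
Proof.
move=> [U0 PU0]; pose Q n := `[< exists2 U, P U & \dim U = n >].
have exQ : exists n, Q n by exists (\dim U0); apply/asboolP; exists U0.
case: (ex_minnP exQ) => n /asboolP[U PU <-] minU; exists U; split=> // V PV.
by apply: minU; apply/asboolP; exists V.
Qed.

Lemma dim_max_ex (P : {vspace A} -> Prop) :
  (exists U, P U) -> exists U, P U /\ forall V, P V -> (\dim V <= \dim U)%N.
Proof.
move=> [U0 PU0]; pose Q n := `[< exists2 U, P U & \dim U = n >].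
have exQ : exists n, Q n by exists (\dim U0); apply/asboolP; exists U0.
have leQ n : Q n -> (n <= \dim {:A})%N.
  by move=> /asboolP[U _ <-]; apply: dimvS (subvf U).
case: (ex_maxnP exQ leQ) => n /asboolP[U PU <-] maxU; exists U; split=> // V PV.
by apply: maxU; apply/asboolP; exists V.
Qed.

Lemma jacobson_exists :
  exists J : {vspace A}, forall x,
    x \in J <-> forall M, maximal_left_ideal M -> x \in M.
Proof.
have [|J [sJ maxJ]] := dim_max_ex (P := fun U =>
  forall M, maximal_left_ideal M -> (U <= M)%VS).
  by exists 0%VS => M _; apply: sub0v.
exists J => x; split=> [Jx M /sJ/subvP|xM]; first exact.
suff /eqP-> : J == (J + <[x]>)%VS by rewrite memvE addvSr.
rewrite eqEdim addvSl maxJ // => M maxM.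
by rewrite subv_add sJ //= -memvE xM.
Qed.

Definition jacobson : {vspace A} := sval (cid jacobson_exists).

Lemma jacobsonP x :
  x \in jacobson <-> forall M, maximal_left_ideal M -> x \in M.
Proof. by rewrite /jacobson; case: cid. Qed.

Lemma left_idealP U :
  reflect (forall a x, x \in U -> a * x \in U) (left_ideal U).
Proof.
apply: (iffP prodvP) => [idU a x Ux | idU a x _ Ux]; last exact: idU.
by apply: idU => //; apply: memvf.
Qed.

Lemma left_ideal_sub_maximal U :
    left_ideal U -> U != fullv ->
  exists2 M, maximal_left_ideal M & (U <= M)%VS.
Proof.
move=> idU neU; have [|M [[idM neM sUM] maxM]] := dim_max_ex (P := fun V =>
  [/\ left_ideal V, V != fullv & (U <= V)%VS]).
  by exists U; split.
exists M => //; split=> // V idV sMV; have [->|neV] := eqVneq V fullv.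
  by right.
left; apply/esym/eqP; rewrite eqEdim sMV maxM //; split=> //.
exact: subv_trans sMV.
Qed.

Lemma jacobson_left_ideal : left_ideal jacobson.
Proof.
apply/left_idealP=> a x /jacobsonP Jx; apply/jacobsonP=> M maxM.
by case: (maxM) => /left_idealP idM _ _; apply/idM/Jx.
Qed.

Lemma jacobson_fix x y : x \in jacobson -> y = x * y -> y = 0.
Proof.
move=> /jacobsonP Jx defy.
have [z def1] : exists z, z * (1 - x) = 1.
  have idU : left_ideal (limg (amulr (1 - x))).
    apply/left_idealP=> a _ /memv_imgP[u _ ->]; rewrite lfunE /= mulrA.
    by apply/memv_imgP; exists (a * u); rewrite ?memvf // lfunE.
  have [defU | /(left_ideal_sub_maximal idU)[M maxM sUM]] :=
      eqVneq (limg (amulr (1 - x))) fullv.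
    have: 1 \in limg (amulr (1 - x)) by rewrite defU memvf.
    by case/memv_imgP=> z _ def1; exists z; rewrite [RHS]def1 lfunE.
  case: (maxM) => /left_idealP idM /negP neM _; case: neM.
  rewrite eqEsubv subvf.
  have M1: 1 \in M.
    rewrite -(subrK x 1) memvD ?Jx // (subvP sUM) //.
    by apply/memv_imgP; exists 1; rewrite ?memvf // lfunE /= mul1r.
  by apply/subvP=> u _; rewrite -(mulr1 u) idM.
by rewrite -[y]mul1r -def1 -mulrA mulrBl mul1r -defy subrr mulr0.
Qed.

Lemma jacobson_nilpotent : exists n, (jacobson ^+ n == 0)%VS.
Proof.
set J := jacobson.
have sJ n : (J ^+ n.+2 <= J ^+ n.+1)%VS.
  rewrite expvSl [X in (_ <= X)%VS]expvSl expvSl prodvA prodvSl //.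
  exact: subv_trans (prodvSl _ (subvf J)) jacobson_left_ideal.
have sJD m n : (J ^+ (m + n).+1 <= J ^+ n.+1)%VS.
  by elim: m => // m IHm; rewrite addSn; apply: subv_trans (sJ _) IHm.
have [|_ [[n ->] minN]] := dim_min_ex (P := fun U => exists n, U = (J ^+ n.+1)%VS).
  by exists J, 0%N.
exists n.+1; apply/negPn/negP; set N := (J ^+ n.+1)%VS => nzN.
have NN : (N * N)%VS = N.
  apply/eqP; rewrite eqEdim -expvD addSn addnS -addSn sJD /=.
  by apply: minN; eexists.
have sNJ : (N <= J)%VS by have := sJD n 0%N; rewrite addn0.
have idN : left_ideal N.
  by rewrite /left_ideal /N expvSl prodvA prodvSl //; apply: jacobson_left_ideal.
have [|L [[idL nzNL] minL]] := dim_min_ex (P := fun U =>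
  left_ideal U /\ (N * U != 0)%VS); first by exists N; rewrite NN.
have [a La nzNa] : exists2 a, a \in L & (N * <[a]> != 0)%VS.
  apply: contrapT => noa; case/negP: nzNL; rewrite -subv0.
  apply/prodvP=> x a Nx La; have [->|nza] := eqVneq (x * a) 0; first exact: mem0v.
  case: noa; exists a => //; apply: contraNneq nza => Na0.
  by rewrite -memv0 -Na0 memv_mul ?memv_line.
have sNaL : (N * <[a]> <= L)%VS.
  apply: subv_trans idL; apply: prodvS; first exact: subvf.
  by rewrite -memvE.
have /eqP defL : (N * <[a]> == L)%VS.
  rewrite eqEdim sNaL minL //; split; last by rewrite prodvA NN.
  by rewrite /left_ideal prodvA prodvSl.
have: a \in (N * <[a]>)%VS by rewrite defL.
have -> : (N * <[a]>)%VS = (amulr a @: N)%VS.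
  apply/eqP; rewrite eqEsubv; apply/andP; split.
    apply/prodvP=> x _ Nx /vlineP[k ->]; rewrite -scalerAr memvZ //.
    by apply/memv_imgP; exists x; rewrite ?lfunE.
  by apply/subvP=> _ /memv_imgP[x Nx ->]; rewrite lfunE memv_mul ?memv_line.
case/memv_imgP=> x Nx; rewrite lfunE /= => defa.
have a0 : a = 0 := jacobson_fix (subvP sNJ x Nx) defa.
by case/negP: nzNa; rewrite a0 -subv0; apply/prodvP=> y _ _ /vlineP[k ->];
   rewrite scaler0 mulr0 mem0v.
Qed.

(* Here jacobson ^+ 0 is the line of 1, not A; both are nonzero, so the
   exponent 0 is excluded either way.                                         *)
Definition loewy_length : nat := ex_minn jacobson_nilpotent.

End Algebra.

Section Blocks.

Variables (F : fieldType) (gT : finGroupType).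
Implicit Types (a : galg F gT) (B : {aspace galg F gT}) (H D : {group gT}).

(* {aspace _} only requires B to have an identity algid B (not the identity of
   F[gT]), as every nonzero ideal direct summand does, and excludes B = 0; algid B is
   the block idempotent.                                                      *)
Definition is_block B : Prop :=
  [/\ two_sided_ideal B,
      exists C : {vspace galg F gT},
        [/\ two_sided_ideal C, (B + C)%VS = fullv & (B :&: C)%VS = 0%VS]
    & forall U V : {vspace galg F gT},
        two_sided_ideal U -> two_sided_ideal V ->
        (U + V)%VS = B -> (U :&: V)%VS = 0%VS -> U = 0%VS \/ V = 0%VS].

Definition galg_conj a (g : gT) : galg F gT := gelt F g^-1 * a * gelt F g.

Definition galg_fixed H a : Prop := {in H, forall g, galg_conj a g = a}.

(* The terms depend on the representatives only when a is not H-fixed. *)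
Definition rel_trace H a : galg F gT :=
  \sum_(C in rcosets H [set: gT]) galg_conj a (repr C).

Definition block_projective B H : Prop :=
  exists2 a, galg_fixed H a & rel_trace H a = algid B.

Definition is_defect_group B D : Prop :=
  block_projective B D /\
  forall H, H \subset D -> block_projective B H -> H :=: D.

End Blocks.

(* Grp quantifies over finite images only; the presented group is finite, of
   order p ^ d for p prime and d >= 3, so this is a genuine isomorphism with
   it. A non-abelian D of order p ^ d forces d >= 3.                          *)
Definition isog_W (gT : finGroupType) (D : {group gT}) (p d : nat) : Prop :=
  D \isog Grp (x : y : z :
    x ^+ (p ^ (d - 2))%N, y ^+ p, z ^+ p, [~ x, y], [~ x, z],
    [~ y, z] = x ^+ (p ^ (d - 3))%N).

(* Main.v *)
(* A power of the Jacobson radical of Z(FG) is spanned by products of nilpotent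
   class functions, so the task is to count how many of them annihilate the block
   idempotent e.  A nilpotent class function annihilates every class function
   that is constant on p-sections.  Applied in C_G(P), this shows that |Z(P)|
   factors send a class function whose Brauer images vanish at all p-subgroups
   Q > P to one whose Brauer image vanishes at P as well.

   The subgroups R of index p in D that are abelian need more care.  As D is
   minimal, a block f of C_G(R) below e is fixed by a p-element t acting
   nontrivially on R.  The centre of f is FR, and a t-fixed nilpotent element of
   FR lies in the ideal generated by the augmentation ideal of any proper
   subgroup of R containing C_R(t)[R,t]; hence p^(d-2) factors suffice at R.

   Descending through the orders p^d, p^(d-1), ..., 1 costs at most
   p^(d-2) + p^(d-3) + (1 + p + ... + p^(d-2)) < 3p^(d-2) factors when p is odd.
   For p = 2 one argues by induction on |D/R| for central p-subgroups R of G: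
   if |D/R| = p^q then p^(q-1) factors annihilate the product of e with the sum
   of the elements of R.  So the first alternative of the theorem always holds. *)

Require Import Defs.
From mathcomp Require Import all_boot all_order all_algebra all_fingroup.
From mathcomp Require Import all_solvable all_field.
From mathcomp Require Import boolp zify.

Set Implicit Arguments.
Unset Strict Implicit.
Unset Printing Implicit Defensive.

Import GroupScope GRing.Theory.

Local Open Scope ring_scope.

(** The class functions constant on p-sections, that is depending only on the p'-part of their
    argument, form the Reynolds ideal of Z(FG), which the radical of Z(FG) annihilates. The rest
    counts how many factors push a function into that ideal.

    In the descent a subgroup P costs |Z(P)|. The centre of a non-abelian P has index at least p^2,
    whence p^(d-2) at order p^d and p^(d-3) at order p^(d-1); for smaller orders p^k the trivial
    bound p^k suffices. An abelian R of order p^(d-1) would cost p^(d-1), more than all smaller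
    orders together, and this is what the fusion argument repairs. It works on e itself, not on what
    the factors for order p^d have produced, so both draw on the same p^(d-2) factors.

    For p = 2 the smaller orders alone cost 2^(d-1) - 1, all that the theorem allows. The second
    method therefore asks only for invariance under translation by a p-element u instead of
    vanishing there. This saves one of the rounds of factors spent at u, and the saving pays for the
    final factor. *)

Section PgroupSum.

Variables (F : fieldType) (p : nat).
Hypothesis pF : p \in [pchar F].

(** A nontrivial orbit of a p-group has length divisible by p, so its contribution vanishes in
    characteristic p. The Brauer map, the trace formula and the fusion argument all rest on this. *)
Lemma pgroup_sum_fix (aT : finGroupType) (D : {group aT}) (T : finType)
    (to : action D T) (P : {group aT}) (S : {set T}) (f : T -> F) :
    p.-group P -> [acts P, on S | to] ->
    (forall a x, a \in P -> x \in S -> f (to x a) = f x) ->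
  \sum_(x in S) f x = \sum_(x in 'Fix_(S | to)(P)) f x.
Proof.
move=> pP actS fP; have sPD := acts_dom actS.
rewrite (set_partition_big _ (orbit_partition actS)) /=.
have orb x y : x \in S -> y \in orbit to P x -> f y = f x.
  by move=> Sx /orbitP[a Pa <-]; apply: fP.
have sumO x : x \in S -> \sum_(y in orbit to P x) f y = f x *+ #|orbit to P x|.
  by move=> Sx; rewrite (eq_bigr (fun=> f x)) ?sumr_const // => y; apply: orb.
rewrite (bigID (fun B : {set T} => #|B| == 1%N)) /= [X in _ + X]big1 ?addr0.
  rewrite (eq_bigl (mem (set1 @: 'Fix_(S | to)(P)))) => [|B].
    rewrite big_imset /=; last by move=> x y _ _; apply: set1_inj.
    by apply: eq_bigr => x _; rewrite big_set1.
  apply/andP/imsetP=> [[/imsetP[x Sx ->] /eqP O1]|[x]].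
    have Ox: orbit to P x = [set x].
      by apply/esym/eqP; rewrite eqEcard O1 cards1 leqnn sub1set orbit_refl.
    exists x => //; rewrite inE Sx; apply/afixP=> a Pa.
    by apply/set1P; rewrite -Ox mem_orbit.
  rewrite inE => /andP[Sx fx] ->; rewrite cards1; split=> //.
  by apply/imsetP; exists x => //; apply/esym/orbit1P.
move=> B /andP[/imsetP[x Sx ->]] ne1; rewrite sumO //.
have: p.-nat #|orbit to P x|.
  by rewrite card_orbit_in // (pnat_dvd (dvdn_indexg _ _)).
case/p_natP=> [[|n] defn]; first by rewrite defn in ne1.
by rewrite defn expnS mulrnA -[f x *+ p]mulr_natr (pcharf0 pF) mulr0 mul0rn.
Qed.

End PgroupSum.

(** * Class functions as centres of group algebras *)

Section Central.

Variables (F : fieldType) (gT : finGroupType).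
Implicit Types (a b c : galg F gT) (H K P : {group gT}).
Local Notation A := (galg F gT).

Lemma gelt_mulE g a x : (gelt F g * a) x = a (g^-1 * x)%g.
Proof.
rewrite galg_mulE (bigD1 g) //= ffunE eqxx mul1r.
by rewrite big1 ?addr0 // => y /negPf ne; rewrite ffunE ne mul0r.
Qed.

Lemma mul_geltE g a x : (a * gelt F g) x = a (x * g^-1)%g.
Proof.
rewrite galg_mulE (bigD1 (x * g^-1)%g) //= ffunE.
rewrite invMg invgK mulgKV eqxx mulr1 big1 ?addr0 // => y ne.
rewrite ffunE; case: eqP => [yxg|]; last by rewrite mulr0.
by case/eqP: ne; rewrite -yxg invMg invgK mulKVg.
Qed.

Lemma gelt1 : gelt F (1%g : gT) = 1. Proof. by []. Qed.

Lemma geltX (g : gT) n : gelt F g ^+ n = gelt F (g ^+ n)%g.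
Proof. by elim: n => [|n IHn]; rewrite ?gelt1 // exprS expgS IHn geltM. Qed.

Lemma galg_conjE a g x : galg_conj a g x = a (x ^ g^-1)%g.
Proof. by rewrite /galg_conj mul_geltE gelt_mulE invgK conjgE invgK. Qed.

Lemma galg_addE a b x : (a + b) x = a x + b x. Proof. exact: ffunE. Qed.
Lemma galg_subE a b x : (a - b) x = a x - b x. Proof. by rewrite !ffunE. Qed.
Lemma galg_scaleE k a x : (k *: a) x = k * a x. Proof. exact: ffunE. Qed.
Lemma galg_0E x : (0 : A) x = 0. Proof. exact: ffunE. Qed.
Lemma galg_1E x : (1 : A) x = (x == 1%g)%:R. Proof. exact: ffunE. Qed.
Lemma galg_sumE I (r : seq I) (Q : pred I) (f : I -> A) x :
  (\sum_(i <- r | Q i) f i) x = \sum_(i <- r | Q i) f i x.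
Proof. by elim/big_rec2: _ => [|i y1 y2 _ <-]; rewrite ffunE. Qed.

(* [supp_on H] is FH inside FG and [zalg H] is its centre, so passing to a
   subgroup never changes the type.  On [zalg H] the Brauer map at P is the
   restriction [res 'C_H(P)]. *)
Definition supp_on (H : {set gT}) a := forall x, x \notin H -> a x = 0.

Lemma supp_onM H a b : supp_on H a -> supp_on H b -> supp_on H (a * b).
Proof.
move=> Ha Hb x nHx; rewrite galg_mulE big1 // => y _.
have [Hy|/Ha->] := boolP (y \in H); last by rewrite mul0r.
by rewrite Hb ?mulr0 // groupMl ?groupV.
Qed.

Lemma supp_on_gelt (H : {set gT}) g : g \in H -> supp_on H (gelt F g).
Proof. by move=> Hg x; rewrite ffunE; case: eqP => // ->; rewrite Hg. Qed.

Definition zalg (H : {set gT}) a :=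
  supp_on H a /\ forall h x, h \in H -> a (x ^ h)%g = a x.

Lemma zalgD H a b : zalg H a -> zalg H b -> zalg H (a + b).
Proof.
move=> [sa ca] [sb cb]; split=> [x nHx|h x Hh]; rewrite !galg_addE.
  by rewrite sa ?sb ?addr0.
by rewrite ca ?cb.
Qed.

Lemma zalgZ H k a : zalg H a -> zalg H (k *: a).
Proof.
move=> [sa ca]; split=> [x nHx|h x Hh]; rewrite !galg_scaleE.
  by rewrite sa ?mulr0.
by rewrite ca.
Qed.

Lemma zalg0 H : zalg H 0.
Proof. by split=> [x _|h x _]; rewrite !galg_0E. Qed.

Lemma zalgB H a b : zalg H a -> zalg H b -> zalg H (a - b).
Proof. by move=> Ha Hb; rewrite -scaleN1r; apply: zalgD => //;
  apply: zalgZ. Qed.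

Lemma zalg1 H : zalg H 1.
Proof.
split=> [|h x Hh]; first by rewrite -gelt1; apply: supp_on_gelt.
by rewrite !galg_1E -[in LHS](conj1g h) (inj_eq (conjg_inj h)).
Qed.

Lemma zalg_comm H a b : zalg H a -> supp_on H b -> a * b = b * a.
Proof.
move=> [sa ca] sb; apply/ffunP=> x; rewrite !galg_mulE.
rewrite (reindex_inj (h := fun y => (x * y^-1)%g)); last first.
  by move=> y z /mulgI/invg_inj.
apply: eq_bigr => y _; rewrite invMg invgK mulgKV mulrC.
have [Hy|/sb->] := boolP (y \in H); last by rewrite !mul0r.
by congr (_ * _); rewrite -(ca y) // conjgE mulgKV.
Qed.

Lemma zalgM H a b : zalg H a -> zalg H b -> zalg H (a * b).
Proof.
move=> [sa ca] [sb cb]; split=> [|h x Hh]; first exact: supp_onM.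
rewrite !galg_mulE (reindex_inj (conjg_inj h)) /=; apply: eq_bigr => y _.
by rewrite ca // -conjVg -conjMg cb.
Qed.

Lemma zalgX H a n : zalg H a -> zalg H (a ^+ n).
Proof.
by move=> Ha; elim: n => [|n IHn]; [apply: zalg1 | rewrite exprS; apply: zalgM].
Qed.

Lemma zalg_prod H (s : seq A) :
  (forall z, z \in s -> zalg H z) -> zalg H (\prod_(z <- s) z).
Proof.
elim: s => [|z s IHs] Hs; first by rewrite big_nil; apply: zalg1.
rewrite big_cons; apply: zalgM; first by apply: Hs; rewrite mem_head.
by apply: IHs => y sy; apply: Hs; rewrite inE sy orbT.
Qed.

Lemma zalg_sum H I (r : seq I) (Q : pred I) (f : I -> A) :
  (forall i, Q i -> zalg H (f i)) -> zalg H (\sum_(i <- r | Q i) f i).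
Proof. by move=> Hf; elim/big_ind: _ => //; [apply: zalg0 | apply: zalgD]. Qed.

Lemma zalg_gelt H g : g \in 'Z(H) -> zalg H (gelt F g).
Proof.
case/setIP=> Hg /centP cg; split=> [|h x Hh]; first exact: supp_on_gelt.
have gh: (g ^ h = g)%g by apply/conjg_fixP/commgP/cg.
by rewrite !ffunE -{1}gh (inj_eq (conjg_inj h)).
Qed.

Definition res (C : {set gT}) a : A := [ffun x => if x \in C then a x else 0].

Lemma resE (C : {set gT}) a x : res C a x = if x \in C then a x else 0.
Proof. exact: ffunE. Qed.

Lemma zalg_res H K a : K \subset H -> zalg H a -> zalg K (res K a).
Proof.
move=> /subsetP sKH [sa ca]; split=> [x /negPf nKx|h x Kh]; rewrite !resE.
  by rewrite nKx.
by rewrite memJ_norm ?(subsetP (normG K)) // ca ?sKH.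
Qed.

Lemma res1 H : res H 1 = 1.
Proof. by apply/ffunP=> x; rewrite resE galg_1E; case: ifP => // nHx;
  case: eqP nHx => // ->; rewrite group1. Qed.

(** [zalg H] is commutative, so these elements form its Jacobson radical. *)
Definition nilcent (H : {set gT}) a := zalg H a /\ exists n, a ^+ n = 0.

End Central.

(** * The Brauer map *)

Section Brauer.

Variables (F : fieldType) (p : nat) (gT : finGroupType).
Hypothesis pF : p \in [pchar F].
Implicit Types (a b c : galg F gT) (H K P : {group gT}).

(** For [x] centralised by P, conjugation by P permutes the factorisations of [x] as
    [y * (y^-1 * x)] without changing their contribution, and the fixed ones have [y] in
    ['C_H(P)]. *)
Lemma resM H P a b : p.-group P -> P \subset H -> zalg H a -> zalg H b ->
  res 'C_H(P) (a * b) = res 'C_H(P) a * res 'C_H(P) b.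
Proof.
move=> pP sPH [sa ca] [sb cb]; apply/ffunP=> x; rewrite resE.
case: ifP => [Cx|/negbT nCx]; last first.
  by rewrite (@supp_onM _ _ 'C_H(P)) // => y /negPf; rewrite resE => ->.
have [Hx cPx] := setIP Cx; rewrite !galg_mulE.
rewrite (bigID (mem H)) /= [X in _ + X]big1 ?addr0 => [|y /sa->];
  last by rewrite mul0r.
rewrite (pgroup_sum_fix pF (to := 'J%act) pP (S := H)).
- rewrite afixJ [LHS](_ : _ = \sum_(y in 'C_H(P)) a y * b (y^-1 * x)%g :> F).
    rewrite [RHS](bigID (mem 'C_H(P))) /= [X in _ = _ + X]big1 ?addr0;
      last first.
      by move=> y /negPf; rewrite resE => ->; rewrite mul0r.
    by apply: eq_bigr => y Cy; rewrite !resE Cy groupMl ?groupV ?Cx.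
  by apply: eq_bigl => y.
- by apply/actsP=> y Py x0; rewrite /= memJ_norm // (subsetP (normG H)) //
  (subsetP sPH).
move=> g y Pg Hy /=; have Hg := subsetP sPH g Pg; rewrite ca //; congr (_ * _).
rewrite -[RHS](cb g) // conjMg conjVg; congr (b (_ * _)%g).
by apply/esym/conjg_fixP/commgP/(centP cPx).
Qed.

Lemma resX H P a n : p.-group P -> P \subset H -> zalg H a ->
  res 'C_H(P) (a ^+ n) = res 'C_H(P) a ^+ n.
Proof.
move=> pP sPH za; elim: n => [|n IHn]; first by rewrite !expr0 res1.
by rewrite !exprS resM ?IHn //; apply: zalgX.
Qed.

Lemma nilcent_res H P a : p.-group P -> P \subset H -> nilcent H a ->
  nilcent 'C_H(P) (res 'C_H(P) a).
Proof.
move=> pP sPH [za [n an0]]; split; first exact: zalg_res (subsetIl _ _) za.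
by exists n; rewrite -resX // an0; apply/ffunP=> x;
  rewrite resE galg_0E if_same.
Qed.

Lemma res_prod H P (s : seq (galg F gT)) : p.-group P -> P \subset H ->
    (forall z, z \in s -> zalg H z) ->
  res 'C_H(P) (\prod_(z <- s) z) = \prod_(z <- s) res 'C_H(P) z.
Proof.
move=> pP sPH; elim: s => [|z s IHs] Hs; first by rewrite !big_nil res1.
have zs y : y \in s -> zalg H y by move=> sy; apply: Hs; rewrite inE sy orbT.
by rewrite !big_cons resM ?IHs //; [apply: Hs;
  rewrite mem_head | apply: zalg_prod].
Qed.

End Brauer.

(** * Nilpotent class functions and p-sections *)

Section Reynolds.

Variables (F : fieldType) (p : nat) (gT : finGroupType).
Hypothesis pF : p \in [pchar F].
Implicit Types (a b c w z : galg F gT) (H K P : {group gT}).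

Lemma galg_expE n a x :
  (a ^+ n) x = \sum_(t : n.-tuple gT)
    (\prod_(g <- t) a g) * ((\prod_(g <- t) g)%g == x)%:R :> F.
Proof.
elim: n x => [|n IHn] x.
  rewrite expr0 galg_1E (big_pred1 [tuple]) => [|t]; last by rewrite [t]tuple0.
  by rewrite !big_nil mul1r eq_sym.
rewrite exprS galg_mulE.
under eq_bigr => y _ do rewrite IHn big_distrr /=.
rewrite pair_bigA /= (reindex (fun yt : gT * n.-tuple gT => cons_tuple yt.1
  yt.2)).
  apply: eq_bigr => -[y t] _ /=; rewrite !big_cons mulrA; congr (_ * _%:R).
  by rewrite -(inj_eq (mulgI y) (\prod_(g <- t) g)%g) mulKVg.
exists (fun t => (thead t, behead_tuple t)) => [[y t] _|t _].
  by congr pair; apply/val_inj.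
by rewrite [RHS]tuple_eta; apply/val_inj.
Qed.

Definition tuple_rot1 (t : p.-tuple gT) : p.-tuple gT := rot_tuple 1 t.

Lemma tuple_rot1_inj : injective tuple_rot1.
Proof. by move=> t u /(congr1 val)/rot_inj/val_inj. Qed.

(* Rotating the factors leaves the conjugacy class of a product unchanged, so
   only the constant tuples survive modulo p. *)
Lemma galg_pow_pchar H a (w : gT -> F) :
    supp_on H a -> (forall h x, h \in H -> w (x ^ h)%g = w x) ->
  \sum_x (a ^+ p) x * w x = \sum_x a x ^+ p * w (x ^+ p)%g.
Proof.
move=> sa cw; have p_pr := pcharf_prime pF.
under eq_bigr => x _ do rewrite galg_expE big_distrl /=.
rewrite exchange_big /=.
pose f (t : p.-tuple gT) : F := (\prod_(g <- t) a g) * w (\prod_(g <- t) g)%g.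
rewrite (eq_bigr f) => [|t _]; last first.
  rewrite (bigD1 (\prod_(g <- t) g)%g) //= eqxx mulr1 [X in _ + X]big1 ?addr0
    // => x ne.
  by rewrite eq_sym (negPf ne) mulr0 mul0r.
pose r := perm tuple_rot1_inj.
have rX k t : (k <= p)%N -> val ((r ^+ k)%g t) = seq.rot k t.
  elim: k => [|k IHk] ltkp; first by rewrite expg0 perm1 rot0.
  rewrite expgSr permM permE /= IHk 1?ltnW // [RHS]rotS //.
  by rewrite size_tuple.
(* A factor outside H makes both sides vanish; otherwise rotation conjugates the product by its
   first factor, an element of H. *)
have fr t : f (tuple_rot1 t) = f t.
  rewrite /f; have [/allP/= Ht|] := boolP (all (mem H) t); last first.
    move=> /allPn[g tg /= nHg]; have trg: g \in tuple_rot1 t by rewrite mem_rot.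
    have prod0 (s : seq gT) : g \in s -> \prod_(h <- s) a h = 0.
      by move=> sg; rewrite (big_rem g) //= sa // mul0r.
    by rewrite !prod0 ?mul0r.
  case: {+}t Ht => [[|g s] szt] Ht; rewrite /tuple_rot1 /=;
    first by rewrite rot_oversize.
  rewrite rot1_cons -cats1 !big_cat !big_cons !big_nil /= mulr1 mulg1.
  congr (_ * _); first exact: mulrC.
  rewrite -[RHS](cw g _ (Ht g (mem_head _ _))).
  by congr w; rewrite conjgE -!mulgA mulKg.
have pr: p.-group <[r]>.
  have: (#[r] %| p)%N.
    rewrite order_dvdn; apply/eqP/permP=> t; rewrite perm1; apply/val_inj.
    by rewrite rX // rot_oversize // size_tuple.
  by move/pnat_dvd; apply; rewrite pnat_id.
have fP (s : {perm p.-tuple gT}) t : s \in <[r]> -> f (s t) = f t.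
  case/cycleP=> k ->; elim: k t => [|k IHk] t; first by rewrite perm1.
  by rewrite expgSr permM permE /= fr.
transitivity (\sum_(t in [set: p.-tuple gT]) f t).
  by apply: eq_bigl => t; rewrite inE.
rewrite (pgroup_sum_fix pF (to := 'P%act) pr) => [|| s t rs _]; last first.
- exact: fP.
- by apply/actsP=> s _ t; rewrite !inE.
have szn (g : gT) : size (nseq p g) == p by rewrite size_nseq.
rewrite (eq_bigl (mem [set Tuple (szn g) | g : gT])) => [|t].
  rewrite big_imset => [|g h _ _ /(congr1 val)/=]; last first.
    by case: (p) p_pr => // n _ [].
  apply: eq_bigr => g _; rewrite /f /= !big_nseq iter_mulr_1.
  by congr (_ * w _); elim: (p) => //= n ->; rewrite expgS.
have rot1_nseq g s : rcons s g = g :: s -> s = nseq (size s) g.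
  by elim: s => //= h s IHs [-> /IHs <-].
rewrite setTI afix_cycle; apply/afix1P/imsetP => [|[g _ ->]].
  case: t => [[|g s] szt]; first by have:= prime_gt0 p_pr;
    rewrite lt0n eq_sym (szt : 0%N == p).
  rewrite /= apermE permE => rt; have /= := congr1 val rt.
  rewrite rot1_cons => rs; have ds := rot1_nseq _ _ _ rs.
  by exists g => //; apply/val_inj; rewrite /= -[in RHS](eqP szt) /= -ds.
rewrite /= apermE permE; apply/val_inj => /=; case: (p) => // n.
by rewrite rot1_cons; elim: n => //= n ->.
Qed.


Definition sect_const (H : {set gT}) w := forall u x, u \in H -> p.-elt u -> x
  \in 'C_H[u] ->
  w (u * x)%g = w x.

(* With [p * k = 1] modulo the p'-part of |H|, the function
   [v x = w (x ^+ k) ^+ p] is again constant on p-sections and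
   [(\sum_x a x * w x) ^+ p = \sum_x (a ^+ p) x * v x]. *)
Lemma nilp_sect_const_eq0 H a (w : gT -> F) n :
    supp_on H a -> a ^+ n = 0 ->
    (forall h x, h \in H -> w (x ^ h)%g = w x) ->
    (forall u x, u \in H -> p.-elt u -> x \in 'C_H[u] -> w (u * x)%g = w x) ->
  \sum_x a x * w x = 0.
Proof.
move=> sa an0; have {n an0}[n an0]: exists n, a ^+ (p ^ n) = 0.
  exists n; rewrite -(subnK (ltnW (ltn_expl n (prime_gt1 (pcharf_prime pF))))).
  by rewrite exprD an0 mulr0.
have p_pr := pcharf_prime pF.
elim: n a sa an0 w => [|n IHn] a sa an0 w cw sw.
  by rewrite -[a]expr1 an0 big1 // => x _; rewrite galg_0E mul0r.
(* By Euler's theorem p^phi(m) is 1 modulo m, so [k] inverts p modulo [m], and [x ^+ (p * k)]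
   differs from [x] by a power of [x] that is a p-element. *)
pose m := (#|H|`_p^')%N; pose k := (p ^ (totient m).-1)%N.
have pk_gt0 : (0 < p * k)%N by rewrite muln_gt0 expn_gt0 prime_gt0.
have m_dv : (m %| (p * k).-1)%N.
  rewrite -subn1 -eqn_mod_dvd // /k -expnS prednK ?totient_gt0 ?part_gt0 //.
  apply/eqP/Euler_exp_totient; apply: (@pnat_coprime p); last exact: part_pnat.
  exact: pnat_id.
pose v x := w (x ^+ k)%g ^+ p.
have suppX b i : supp_on H b -> supp_on H (b ^+ i).
  move=> sb; elim: i => [|i IHi]; last by rewrite exprS; apply: supp_onM.
  by rewrite expr0 -gelt1; apply: supp_on_gelt.
have /eqP: \sum_x (a ^+ p) x * v x = 0.
  apply: IHn; first exact: suppX.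
  - by rewrite -exprM -expnS.
  - by move=> h x Hh; rewrite /v -conjXg cw.
  move=> u x Hu pu /setIP[Hx /cent1P cux]; rewrite /v expgMn //.
  rewrite sw ?groupX ?p_eltX //; apply/setIP; split=> //.
  by apply/cent1P; apply: commuteX.
rewrite (galg_pow_pchar sa) => [|h x Hh]; last by rewrite /v -conjXg cw.
suff ->: \sum_x a x ^+ p * v (x ^+ p)%g = (\sum_x a x * w x) ^+ p.
  by rewrite expf_eq0 => /andP[_ /eqP].
rewrite -(pFrobenius_autE pF) rmorph_sum; apply: eq_bigr => x _.
rewrite /= pFrobenius_autE exprMn; have [Hx|/sa->] := boolP (x \in H);
  last first.
  by rewrite expr0n -[p]prednK ?prime_gt0 //= !mul0r.
congr (_ * _); rewrite /v -expgM; congr (_ ^+ _).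
rewrite -[in RHS](sw (x ^+ (p * k).-1)%g) ?groupX //.
- by rewrite -expgSr prednK.
- have dv: (#[x ^+ (p * k).-1]%g %| #|H|`_p)%N.
    rewrite order_dvdn -expgM -order_dvdn (dvdn_trans (order_dvdG Hx)) //.
    by rewrite -[X in (X %| _)%N](partnC p) // mulnC dvdn_mul.
  by apply: pnat_dvd dv _; apply: part_pnat.
by apply/setIP; split=> //; apply/cent1P; apply: commuteX.
Qed.


(** The coefficient at [x] is the pairing of [gelt F x^-1 * z] with the function sending [y] to
    [w y^-1]. The translate of [z] need not be central but is still nilpotent, hence the generality
    of [nilp_sect_const_eq0]. *)
Lemma nilcent_mul_sect_const H z w : nilcent H z -> zalg H w -> sect_const H w
  -> z * w = 0.
Proof.
move=> [zz [n zn0]] zw sw; apply/ffunP=> x; rewrite galg_0E.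
have [Hx|] := boolP (x \in H); last exact: (zalgM zz zw).1.
have sx: supp_on H (gelt F x^-1) by apply: supp_on_gelt; rewrite groupV.
rewrite galg_mulE (reindex_inj (mulgI x)) /=.
rewrite (eq_bigr (fun y => (gelt F x^-1 * z) y * w y^-1%g)) => [|y _];
  last first.
  by rewrite gelt_mulE invgK invMg mulgKV.
apply: (@nilp_sect_const_eq0 H _ _ n).
- exact: supp_onM sx zz.1.
- by rewrite exprMn_comm ?zn0 ?mulr0 //; apply/esym/(zalg_comm zz sx).
- by move=> h y Hh; rewrite -conjVg zw.2.
move=> u y Hu pu /setIP[Hy /cent1P cyu]; rewrite -cyu invMg sw ?groupV ?p_eltV
  //.
by rewrite inE Hy cent1C groupV cent1C; apply/cent1P.
Qed.

Definition nilcents (H : {set gT}) (zs : seq (galg F gT)) := forall z, z \in zs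
  -> nilcent H z.

Lemma subr1_pchar (x : galg F gT) j : (x - 1) ^+ (p ^ j) = x ^+ (p ^ j) - 1.
Proof.
have pA : p \in [pchar (galg F gT)] by rewrite pchar_lalg.
elim: j => [|j IHj]; first by rewrite !expr1.
rewrite expnSr !exprM IHj -(pFrobenius_autE pA) pFrobenius_autB_comm ?rmorph1
  //.
  by rewrite pFrobenius_aut1 pFrobenius_autE.
exact: commr1.
Qed.

(** If (u - 1)^(i+1) annihilates an element, then its product with (u - 1)^i is fixed by u, and [n]
    factors from [O] kill that. So each round of [n] factors lowers the annihilating power of u - 1
    by one. *)
Lemma kill_rounds (O B : galg F gT -> Prop) (u : gT) (n N : nat) :
    (forall z b, O z -> B b -> B (z * b)) ->
    (forall b, B b -> B (b * (gelt F u - 1))) ->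
    (forall b, B b -> b * gelt F u = b -> forall zs, (forall z, z \in zs -> O
      z) ->
       (n <= size zs)%N -> \prod_(z <- zs) z * b = 0) ->
  forall k b zs, B b -> b * (gelt F u - 1) ^+ N = 0 ->
    (forall z, z \in zs -> O z) -> (k <= N)%N -> (k * n <= size zs)%N ->
  \prod_(z <- zs) z * b * (gelt F u - 1) ^+ (N - k) = 0.
Proof.
move=> OB uB killB; have OsB zs b : (forall z, z \in zs -> O z) -> B b ->
    B (\prod_(z <- zs) z * b).
  elim: zs => [|z zs IHs] Os Bb; first by rewrite big_nil mul1r.
  rewrite big_cons -mulrA; apply: OB; first by apply: Os; rewrite mem_head.
  by apply: IHs => // y sy; apply: Os; rewrite inE sy orbT.
have uXB b i : B b -> B (b * (gelt F u - 1) ^+ i).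
  by elim: i => [|i IHi] Bb; rewrite ?mulr1 // exprSr mulrA; apply/uB/IHi.
elim=> [|k IHk] b zs Bb bN0 Os lekN szs; first by rewrite subn0 -mulrA bN0
  mulr0.
pose m := (size zs - k * n)%N.
have [m_le n_le]: (m <= size zs)%N /\ (n <= m)%N.
  by rewrite leq_subr leq_subRL ?(leq_trans _ szs) // mulSn addnC // leq_addr.
have Ot z : z \in take m zs -> O z by move/mem_take/Os.
have Od z : z \in drop m zs -> O z by move/mem_drop/Os.
rewrite -(cat_take_drop m zs) big_cat -!mulrA /= mulrA -mulrA.
set b1 := _ * (b * _); have Bb1: B b1 by rewrite /b1 mulrA; apply/uXB/OsB.
rewrite killB // ?size_takel //.
apply/eqP; rewrite -subr_eq0 -[X in _ - X]mulr1 -mulrBr /b1 -!mulrA -exprSr.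
rewrite subnSK // mulrA IHk ?size_drop //; first exact: ltnW.
by rewrite subKn // (leq_trans _ szs) // leq_mul.
Qed.

Lemma join_cycle_exp (S : {group gT}) (r : gT) : r \in 'N(S) ->
  (r ^+ #|S <*> <[r]> : S| \in S)%g.
Proof.
move=> nSr; have nS: S <*> <[r]> \subset 'N(S) by rewrite join_subG normG
  cycle_subG.
have nSX k: (r ^+ k \in 'N(S))%g by rewrite groupX.
rewrite coset_idr // morphX // -card_quotient //; apply: expg_cardG.
by rewrite mem_quotient // mem_gen // inE cycle_id orbT.
Qed.

(** By induction on |R : S|, that many factors kill the S-fixed elements of [B]. When [r] is
    adjoined to S, the index N = |S<r> : S| is a power of p, so (r - 1)^N = r^N - 1 annihilates
    S-fixed elements, and N rounds of |R : S<r>| factors suffice. *)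
Lemma kill_descend (R : {group gT}) (O B : galg F gT -> Prop) :
    p.-group R -> abelian R ->
    (forall z b, O z -> B b -> B (z * b)) ->
    (forall r b, r \in R -> B b -> B (b * (gelt F r - 1))) ->
    (forall z b, O z -> B b -> (forall r, r \in R -> b * gelt F r = b) -> z * b
      = 0) ->
  forall b zs, B b -> (forall z, z \in zs -> O z) -> (#|R| <= size zs)%N ->
  \prod_(z <- zs) z * b = 0.
Proof.
move=> pR abR OB RB killB b zs Bb Os szR.
suff main i (S : {group gT}) : (#|R : S| <= i)%N -> S \subset R ->
    forall b zs, B b -> (forall s, s \in S -> b * gelt F s = b) ->
    (forall z, z \in zs -> O z) -> (#|R : S| <= size zs)%N ->
    \prod_(z <- zs) z * b = 0.
  apply: (main _ 1%G) => //; rewrite ?sub1G ?indexg1 //.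
  by move=> s /set1P->; rewrite gelt1 mulr1.
elim: i S => [|i IHi] S; first by rewrite leqNgt indexg_gt0.
move=> leSi sSR {Bb Os szR zs}b zs Bb Sb Os szs.
have [sRS|/subsetPn[r Rr nSr]] := boolP (R \subset S).
  case/lastP: zs Os szs => [|zs z] Os; first by rewrite leqNgt indexg_gt0.
  move=> _; rewrite -cats1 big_cat big_seq1 -mulrA (killB z) ?mulr0 //.
    by apply: Os; rewrite mem_rcons mem_head.
  by move=> s /(subsetP sRS)/Sb.
have cSr: <[r]> \subset 'C(S).
  by rewrite cycle_subG (subsetP (centS sSR)) // (subsetP abR).
have nSr' : r \in 'N(S) by rewrite (subsetP (cent_sub S)) // -cycle_subG.
pose S1 := (S <*> <[r]>)%G; have sS1R: S1 \subset R by rewrite join_subG sSR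
  cycle_subG.
have sSS1: S \subset S1 by apply: joing_subl.
pose N := #|S1 : S|; have rN: (r ^+ N \in S)%g by apply: join_cycle_exp.
have [j Nj]: {j | N = (p ^ j)%N}.
  by apply/p_natP; apply: (pnat_dvd (dvdn_indexg _ _)); apply: pgroupS pR.
have defI: (#|R : S| = N * #|R : S1|)%N by rewrite mulnC (Lagrange_index sS1R
  sSS1).
have N_gt1: (1 < N)%N.
  rewrite indexg_gt1; apply: contra nSr => /subsetP; apply.
  by rewrite mem_gen // inE cycle_id orbT.
suff: \prod_(z <- zs) z * b * (gelt F r - 1) ^+ (N - N) = 0.
  by rewrite subnn expr0 mulr1.
apply: (@kill_rounds O (fun c => B c /\ forall s, s \in S -> c * gelt F s = c) r
  #|R : S1| N) => //.
- move=> z c Oz [Bc Sc]; split; first exact: OB.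
  by move=> s /Sc; rewrite -mulrA => ->.
- move=> c [Bc Sc]; split; first exact: RB.
  move=> s Ss; rewrite -mulrA mulrBl mul1r -geltM (centP (subsetP cSr r
    (cycle_id r)) s Ss).
  by rewrite geltM -[gelt F s in X in _ - X]mulr1 -mulrBr mulrA Sc.
- move=> c [Bc Sc] rc xs Oxs; apply: IHi => //.
    by rewrite -ltnS (leq_trans _ leSi) // defI -[ltnLHS]mul1n ltn_pmul2r.
  move=> s; rewrite /= cent_joinEr // => /mulsgP[s1 _ Ss1 /cycleP[k ->] ->].
  rewrite geltM mulrA Sc //; elim: k => [|k IHk];
    first by rewrite expg0 gelt1 mulr1.
  by rewrite expgS geltM mulrA rc.
- by rewrite Nj subr1_pchar geltX -Nj mulrBr mulr1 Sb // subrr.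
by rewrite -defI.
Qed.

(* [w] is in the kernel of the Brauer map at every p-element outside [Z]. *)
Definition vanish_off (H Z : {set gT}) w := forall u x,
  u \in H -> p.-elt u -> u \notin Z -> x \in 'C_H[u] -> w x = 0.

Lemma vanish_offM H Z z w : zalg H z -> zalg H w -> vanish_off H Z w ->
  vanish_off H Z (z * w).
Proof.
move=> zz zw vw u x Hu pu nZu Cx.
have sUH: <[u]> \subset H by rewrite cycle_subG.
have := resM pF pu sUH zz zw; rewrite cent_cycle => /ffunP/(_ x).
rewrite resE Cx => ->; rewrite galg_mulE big1 // => y _;
  rewrite [X in _ * X]resE.
by case: ifP => [/(vw u)-> //|]; rewrite mulr0.
Qed.

(* A [Z]-invariant such [w] is constant on p-sections: translating by [u]
   outside [Z] relates two zeros. *)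
Lemma central_inv_kill H (Z : {group gT}) z w : Z \subset 'Z(H) ->
    nilcent H z -> zalg H w -> vanish_off H Z w ->
    (forall r, r \in Z -> w * gelt F r = w) ->
  z * w = 0.
Proof.
move=> sZH zz zw vw Zw; apply: nilcent_mul_sect_const zz zw _ => u x Hu pu Cx.
have [Zu|nZu] := boolP (u \in Z).
  have /setIP[_ /centP cu] := subsetP sZH u Zu; rewrite -{1}(Zw u Zu) mul_geltE.
  by rewrite cu ?mulgK //; case/setIP: Cx.
by rewrite !(vw u) // groupM // inE Hu /= cent1id.
Qed.

Lemma central_kill H (Z : {group gT}) w zs : p.-group Z -> Z \subset 'Z(H) ->
    zalg H w -> vanish_off H Z w -> nilcents H zs -> (#|Z| <= size zs)%N ->
  \prod_(z <- zs) z * w = 0.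
Proof.
move=> pZ sZH zw vw zzs szs.
apply: (@kill_descend Z (nilcent H) (fun b => zalg H b /\ vanish_off H Z b)) =>
  //.
- exact: abelianS sZH (center_abelian H).
- move=> z b [zz _] [zb vb]; split; first exact: zalgM.
  exact: vanish_offM.
- move=> r b /(subsetP sZH) Zr [zb vb]; split.
    by apply: zalgM => //; apply: zalgB (zalg_gelt _ Zr) (zalg1 _ _).
  move=> u x Hu pu nZu Cx; rewrite mulrBr mulr1 galg_subE mul_geltE !(vb u)
    ?subr0 //.
  rewrite groupM // groupV inE; have /setIP[-> /centP cr] := Zr.
  exact/cent1P/cr.
by move=> z b zz [zb vb] Zb; apply: central_inv_kill sZH zz zb vb Zb.
Qed.

End Reynolds.

(** * Brauer images and invariants of p-subgroups *)

Section Kill.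

Variables (F : fieldType) (p : nat) (gT : finGroupType).
Hypothesis pF : p \in [pchar F].
Implicit Types (a b c e w z : galg F gT) (H K P Q R : {group gT}).

Lemma chain_kill H P w zs : p.-group P -> P \subset H -> zalg H w ->
    (forall Q, p.-group Q -> Q \subset H -> P \proper Q ->
       forall x, x \in 'C_H(Q) -> w x = 0) ->
    nilcents H zs -> (#|'Z(P)| <= size zs)%N ->
  forall x, x \in 'C_H(P) -> (\prod_(z <- zs) z * w) x = 0.
Proof.
move=> pP sPH zw vw zzs szs x Cx.
have zz : zalg H (\prod_(z <- zs) z) by apply: zalg_prod => z /zzs[].
have := resM pF pP sPH zz zw; rewrite (res_prod pF) => // [|z /zzs[]//].
move/ffunP/(_ x); rewrite resE Cx => ->.
rewrite -(big_map (res 'C_H(P)) xpredT id) /=.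
rewrite (@central_kill _ _ _ pF 'C_H(P)%G 'Z(P)%G) ?galg_0E ?size_map //.
- exact: pgroupS (center_sub P) pP.
- rewrite subsetI setISS //=; apply: subset_trans (center_sub P) _.
  by rewrite centsC subsetIr.
- exact: zalg_res (subsetIl _ _) zw.
(* A p-element [u] of ['C_H(P)] outside ['Z(P)] generates with P a strictly larger p-subgroup, and
   [y] centralises it. *)
- move=> u y /setIP[Hu cPu] pu nZu /setIP[Cy /cent1P cyu].
  rewrite resE; case: ifP => // _; have [Hy cPy] := setIP Cy.
  have cPU : <[u]> \subset 'C(P) by rewrite cycle_subG.
  apply: (vw (P <*> <[u]>)%G) => //.
  - by rewrite /= cent_joinEr // pgroupM pP.
  - by rewrite join_subG sPH cycle_subG.
  - rewrite properE joing_subl; apply: contra nZu => /subsetP sPu.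
    by rewrite inE cPu andbT sPu // mem_gen // inE cycle_id orbT.
  by rewrite inE Hy centY inE cPy cent_cycle; apply/cent1P.
by move=> _ /mapP[z /zzs zz1 ->]; apply: (nilcent_res pF).
Qed.

Definition sumg (R : {set gT}) : galg F gT := \sum_(r in R) gelt F r.

Lemma sumgE (R : {set gT}) x : sumg R x = (x \in R)%:R :> F.
Proof.
rewrite /sumg galg_sumE; have [Rx|nRx] := boolP (x \in R).
  rewrite (bigD1 x) //= ffunE eqxx big1 ?addr0 // => y /andP[_ ne].
  by rewrite ffunE eq_sym (negPf ne).
by rewrite big1 // => y Ry; rewrite ffunE; case: eqP nRx Ry => // -> /negPf->.
Qed.

Lemma gelt_sumg R r : r \in R -> gelt F r * sumg R = sumg R.
Proof.
by move=> Rr; apply/ffunP=> x; rewrite gelt_mulE !sumgE groupMl ?groupV.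
Qed.

Lemma sumg_gelt R r : r \in R -> sumg R * gelt F r = sumg R.
Proof.
by move=> Rr; apply/ffunP=> x; rewrite mul_geltE !sumgE groupMr ?groupV.
Qed.

Lemma zalg_sumg H R : R \subset 'Z(H) -> zalg H (sumg R).
Proof. by move=> /subsetP sRZ; apply: zalg_sum => r /sRZ; apply: zalg_gelt. Qed.

Lemma sumg1 : sumg 1%G = 1.
Proof. by rewrite /sumg big_set1. Qed.

(** FG is free over FR on coset representatives, so an R-fixed element is determined by its values
    at the representatives, which [c] retains. *)
Lemma inv_factor R b : (forall r, r \in R -> gelt F r * b = b) ->
  exists c, b = sumg R * c.
Proof.
move=> Rb; exists [ffun x => if x == repr (R :* x) then b x else 0].
apply/ffunP=> x; rewrite galg_mulE.
pose r0 := (x * (repr (R :* x))^-1)%g.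
have Rr0 : r0 \in R.
  by rewrite -groupV invMg invgK -mem_rcoset mem_repr_rcoset.
have r0x : (r0^-1 * x = repr (R :* x))%g by rewrite invMg invgK mulgKV.
have rx r : r \in R -> (R :* (r^-1 * x) = R :* x)%g.
  by move=> Rr; rewrite rcosetM [(R :* r^-1)%g]rcoset_id ?groupV.
rewrite (bigD1 r0) //= big1 ?addr0 => [|r ne].
  rewrite sumgE Rr0 ffunE rx // -{1}r0x eqxx mul1r.
  by rewrite -[LHS](congr1 (fun c => c x) (Rb r0 Rr0)) gelt_mulE.
rewrite sumgE; have [Rr|_] := boolP (r \in R); last by rewrite mul0r.
rewrite ffunE rx //; case: eqP => [rxr|]; last by rewrite mulr0.
case/eqP: ne; rewrite /r0 -rxr invMg invgK mulgA mulgV mul1g //.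
Qed.

Lemma res_id (C : {set gT}) a : supp_on C a -> res C a = a.
Proof. by move=> sa; apply/ffunP=> x; rewrite resE; case: ifPn => // /sa. Qed.

(* Modulo R, the sum over R<u> is (u - 1)^(N - 1), N = |R<u> : R|.  So n factors
   turn (u - 1)^i-torsion into (u - 1)^(i-1)-torsion, and (N - 1) * n factors
   leave u-invariance. *)
Lemma sect_const_step H R e zs u n : p.-group R -> R \subset 'Z(H) ->
    zalg H e -> e * e = e -> nilcents H zs -> u \in H -> p.-elt u ->
    (forall ys, nilcents 'C_H[u] ys -> (n <= size ys)%N ->
       \prod_(z <- ys) z * res 'C_H[u] e * sumg (R <*> <[u]>) = 0) ->
    (#|R <*> <[u]> : R|.-1 * n <= size zs)%N ->
  forall x, x \in 'C_H[u] ->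
    (\prod_(z <- zs) z * e * sumg R) (u * x)%g = (\prod_(z <- zs) z * e * sumg
      R) x.
Proof.
move=> pR sRZ ze ee zzs Hu pu kill szs x Cx; set C := 'C_H[u];
  pose N := #|R <*> <[u]> : R|; rewrite -/N in szs.
have zz : zalg H (\prod_(z <- zs) z) by apply: zalg_prod => z /zzs[].
have sUH : <[u]> \subset H by rewrite cycle_subG.
have RH : R \subset H := subset_trans sRZ (center_sub H).
have cR r h : r \in R -> h \in H -> commute r h.
  by move=> /(subsetP sRZ)/setIP[_ /centP cr] /cr.
have sRC : R \subset C.
  apply/subsetP=> r Rr; rewrite inE (subsetP RH) //; exact/cent1P/cR.
have ZC : R \subset 'Z(C).
  rewrite subsetI sRC; apply/subsetP=> r Rr; apply/centP=> h /setIP[Hh _].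
  exact: cR.
have uC : u \in C by rewrite inE Hu cent1id.
have cu h : h \in C -> commute h u by case/setIP=> _ /cent1P.
have zR := zalg_sumg sRZ.
set W := _ * _ * _; have zW : zalg H W by do !apply: zalgM.
have resW : res C W = \prod_(z <- map (res C) zs) z * (res C e * sumg R).
  have resm := resM pF pu sUH; rewrite cent_cycle -/C in resm.
  rewrite /W resm //; last exact: zalgM.
  rewrite resm // [res C (sumg R)]res_id ?mulrA; last by case: (zalg_sumg ZC).
  have := @res_prod _ _ _ pF H <[u]>%G zs pu sUH; rewrite cent_cycle -/C => ->.
    by rewrite big_map.
  by move=> z /zzs[].
suff: res C W * gelt F u = res C W.
  move/ffunP/(_ (x * u)%g); rewrite mul_geltE mulgK !resE Cx groupMr // Cx =>
    ->.
  by rewrite (cu x Cx).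
have pRu : p.-group (R <*> <[u]>).
  rewrite cent_joinEr ?pgroupM ?pR // cycle_subG; apply/centP=> r Rr.
  exact/commute_sym/cR.
have nRu : u \in 'N(R).
  by apply: (subsetP (cent_sub R)); apply/centP=> r Rr; apply/commute_sym/cR.
have [j Nj]: {j | N = (p ^ j)%N} by apply/p_natP/(pnat_dvd (dvdn_indexg _ _)).
have zeC : zalg C (res C e) := zalg_res (subsetIl _ _) ze.
have eeC : res C e * res C e = res C e.
  by have := resM pF pu sUH ze ze; rewrite cent_cycle -/C ee => <-.
have cg z r : zalg C z -> r \in C -> gelt F r * z = z * gelt F r.
  by move=> zC Cr; rewrite (zalg_comm zC) //; apply: supp_on_gelt.
have sRCr r : r \in R -> r \in C by apply: (subsetP sRC).
pose B b := [/\ res C e * b = b, forall r, r \in R -> gelt F r * b = b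
                & gelt F u * b = b * gelt F u].
suff: \prod_(z <- map (res C) zs) z * (res C e * sumg R)
        * (gelt F u - 1) ^+ (N - N.-1) = 0.
  have -> : (N - N.-1 = 1)%N by rewrite -subn1 subKn // indexg_gt0.
  by rewrite expr1 -resW mulrBr mulr1 => /eqP; rewrite subr_eq0 => /eqP.
apply: (@kill_rounds _ _ (nilcent C) B u n N) => //.
- move=> z b [zzC _] [eb Rb ub]; split.
  + by rewrite mulrA -(zalg_comm zzC zeC.1) -mulrA eb.
  + by move=> r Rr; rewrite mulrA (cg z) ?sRCr // -mulrA Rb.
  by rewrite mulrA (cg z) // -mulrA ub mulrA.
- move=> b [eb Rb ub]; split; first by rewrite mulrA eb.
    by move=> r Rr; rewrite mulrA Rb.
  by rewrite mulrA ub -!mulrA mulrBl mulrBr mul1r mulr1.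
(* Fixed by R and by [u], [b] is a multiple of [sumg (R <*> <[u]>)], so [kill] applies. *)
- move=> b [eb Rb ub] bu ys zys sys.
  have [|c defb] := @inv_factor (R <*> <[u]>)%G b.
    move=> r; rewrite /= cent_joinEr.
      case/mulsgP=> r1 _ Rr1 /cycleP[k ->] ->; rewrite geltM -mulrA.
      suff ->: gelt F (u ^+ k) * b = b by apply: Rb.
      elim: k => [|k IHk]; first by rewrite expg0 gelt1 mul1r.
      by rewrite expgSr geltM -mulrA ub bu.
    by rewrite cycle_subG; apply/centP=> r1 Rr1; apply/commute_sym/cR.
  by rewrite -eb defb !mulrA kill // mul0r.
- split.
  + by rewrite mulrA eeC.
  + move=> r Rr; rewrite mulrA (cg _ _ zeC) ?sRCr //.
    by rewrite -mulrA gelt_sumg.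
  exact: cg (zalgM zeC (zalg_sumg ZC)) uC.
- rewrite Nj subr1_pchar // geltX -Nj mulrBr mulr1 -mulrA sumg_gelt ?subrr //.
  exact: join_cycle_exp.
- by move=> _ /mapP[z /zzs zz1 ->]; have := nilcent_res pF pu sUH zz1;
  rewrite cent_cycle.
- exact: leq_pred.
by rewrite size_map.
Qed.

End Kill.

(** * Non-abelian defect over a central p-subgroup *)

Section NonAbelian.

Variables (F : fieldType) (p : nat) (gT : finGroupType).
Hypothesis pF : p \in [pchar F].
Implicit Types (a b c e w z : galg F gT) (H K P Q R : {group gT}).

Lemma center_cent1 H R u : R \subset 'Z(H) -> u \in H -> R \subset 'Z('C_H[u]).
Proof.
move=> sRZ Hu; apply/subsetP=> r /(subsetP sRZ)/setIP[Hr /centP cr].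
apply/setIP; split; first by rewrite inE Hr; apply/cent1P/cr.
by apply/centP=> h /setIP[/cr].
Qed.

(* The p-subgroups with nonzero Brauer image of [e] play the role of the
   subgroups of a defect group; modulo the central R their orders are at most
   p ^ q, and those reaching the bound are non-abelian. *)
Definition nonabelian_defect q H R e := forall P x,
  p.-group P -> P \subset H -> x \in 'C_H(P) -> e x != 0 ->
  (#|P| <= #|R| * p ^ q)%N /\ (#|P| = (#|R| * p ^ q)%N -> ~~ abelian P).

(** Adjoining [u] to R moves p^j from the second factor of the bound |R| p^q to the first. If q <=
    j, the abelian group R<u> itself would reach or exceed the bound, so the image of [e] is
    zero. *)
Lemma nonabelian_defect_cent q H R e u j :
    p.-group R -> R \subset 'Z(H) -> u \in H -> p.-elt u ->
    #|R <*> <[u]> : R| = (p ^ j)%N -> nonabelian_defect q H R e ->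
  [/\ nonabelian_defect (q - j) 'C_H[u] (R <*> <[u]>) (res 'C_H[u] e) \/ res
    'C_H[u] e = 0,
      p.-group (R <*> <[u]>), R <*> <[u]> \subset 'Z('C_H[u])
    & (q <= j)%N -> res 'C_H[u] e = 0].
Proof.
move=> pR sRZ Hu pu Nj dH; set C := 'C_H[u]; set S := R <*> <[u]>.
have RH : R \subset H := subset_trans sRZ (center_sub H).
have cRu : <[u]> \subset 'C(R).
  rewrite cycle_subG; apply/centP=> r Rr; apply/commute_sym.
  by have /setIP[_ /centP cr] := subsetP sRZ r Rr; apply: cr.
have pS : p.-group S by rewrite /S cent_joinEr // pgroupM pR.
have sSZ : S \subset 'Z(C).
  rewrite join_subG cycle_subG center_cent1 //= inE inE Hu cent1id /=.
  by apply/centP=> x /setIP[_ /cent1P]/commute_sym.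
have cardS : #|S| = (#|R| * p ^ j)%N by rewrite -Nj Lagrange // joing_subl.
have abS : abelian S := abelianS sSZ (center_abelian _).
have SH : S \subset H.
  by rewrite join_subG RH cycle_subG.
have e0 : (q <= j)%N -> res C e = 0.
  move=> leqj; apply/ffunP=> x; rewrite resE galg_0E; case: ifP => // Cx.
  apply/eqP/negPn/negP=> nz_ex; have xCS : x \in 'C_H(S).
    rewrite inE (subsetP _ _ Cx) ?subsetIl //= (subsetP _ _ Cx) // centsC.
    by apply: subset_trans sSZ _; rewrite subsetIr.
  have [leS nabS] := dH [group of S] x pS SH xCS nz_ex.
  move: leS nabS; rewrite /= cardS leq_pmul2l ?cardG_gt0 //.
  rewrite leq_exp2l ?prime_gt1 ?(pcharf_prime pF) // => lejq.
  have ->: j = q by apply/eqP; rewrite eqn_leq lejq.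
  by move/(_ (erefl _)); rewrite abS.
split=> //; have [leqj|ltjq] := leqP q j; [right; exact: e0 | left].
move=> P x pP sPC Cx; rewrite resE; case: ifP => [_ nzx|]; last by rewrite eqxx.
have [Hx cx] := setIP Cx.
have := dH P x pP (subset_trans sPC (subsetIl _ _)) _ nzx.
rewrite inE cx (subsetP _ _ Hx) ?subsetIl //= => /(_ isT).
by rewrite cardS -mulnA -expnD subnKC // ltnW.
Qed.

(** One factor is kept back to annihilate a section-constant function. If |R<u> : R| = p^j with j <
    q, invariance under [u] costs (p^j - 1) p^(q-1-j) = p^(q-1) - p^(q-1-j) factors, at most the
    p^(q-1) - 1 that remain; for j >= q it costs none. For q = 0 the abelian R would attain the
    bound, so e = 0. *)
Lemma nonabelian_kill q H R e zs : p.-group R -> R \subset 'Z(H) ->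
    zalg H e -> e * e = e -> nonabelian_defect q H R e -> nilcents H zs ->
    (p ^ q.-1 <= size zs)%N ->
  \prod_(z <- zs) z * e * sumg F R = 0.
Proof.
have p_gt1 := prime_gt1 (pcharf_prime pF).
elim/ltn_ind: q H R e zs => -[|q] IH H R e zs pR sRZ ze ee dH zzs szs.
  suff ->: e = 0 by rewrite mulr0 mul0r.
  apply/ffunP=> x; rewrite galg_0E; apply/eqP/negPn/negP=> nzx.
  have RH : R \subset H := subset_trans sRZ (center_sub H).
  have Hx : x \in H by apply: contraR nzx => /ze.1->.
  have [|_] := dH R x pR RH _ nzx.
    rewrite inE Hx; apply/centP=> r /(subsetP sRZ)/setIP[_ /centP cr].
    exact/commute_sym/cr.
  by rewrite muln1 (abelianS sRZ (center_abelian _)) => /(_ (erefl _)).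
case: zs zzs szs => [|z zs] zzs szs; first by rewrite leqNgt expn_gt0 ltnW in
  szs.
have zzs' : nilcents H zs by move=> y sy; apply: zzs; rewrite inE sy orbT.
have zW : zalg H (\prod_(z <- zs) z * e * sumg F R).
  apply: zalgM (zalg_sumg _ sRZ); apply: zalgM ze.
  by apply: zalg_prod => y /zzs'[].
have -> : \prod_(y <- z :: zs) y * e * sumg F R = z * (\prod_(y <- zs) y * e *
  sumg F R).
  by rewrite big_cons -!mulrA.
apply: (nilcent_mul_sect_const pF (zzs z (mem_head _ _)) zW) => u x Hu pu Cx.
have [Ru|nRu] := boolP (u \in R).
  have /setIP[_ /centP cu] := subsetP sRZ u Ru.
  rewrite cu; last by case/setIP: Cx.
  have := sumg_gelt F Ru => /(congr1 (fun c => \prod_(z <- zs) z * e * c)).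
  by rewrite mulrA => /ffunP/(_ (x * u)%g); rewrite mul_geltE mulgK => ->.
have nRu' : u \in 'N(R).
  apply: (subsetP (cent_sub R)); apply/centP=> r Rr; apply/commute_sym.
  by have /setIP[_ /centP cr] := subsetP sRZ r Rr; apply: cr.
have [j Nj]: {j | #|R <*> <[u]> : R| = (p ^ j)%N}.
  apply/p_natP/(pnat_dvd (dvdn_indexg _ _)).
  have cRu : <[u]> \subset 'C(R).
    rewrite cycle_subG; apply/centP=> r Rr; apply/commute_sym.
    by have /setIP[_ /centP cr] := subsetP sRZ r Rr; apply: cr.
  by rewrite /= cent_joinEr // -[_.-nat _]/(p.-group _) pgroupM pR.
have j_gt0 : (0 < j)%N.
  have : (1 < p ^ j)%N.
    rewrite -Nj indexg_gt1; apply: contra nRu => /subsetP; apply.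
    by rewrite mem_gen // inE cycle_id orbT.
  by case: (j).
have [dC pS sSZ e0] := nonabelian_defect_cent pR sRZ Hu pu Nj dH.
pose n := if (q.+1 <= j)%N then 0%N else (p ^ (q.+1 - j).-1)%N.
apply: (sect_const_step pF (n := n) pR sRZ ze ee zzs' Hu pu _ _ Cx).
  move=> ys zys; rewrite /n; case: ifP => [/e0-> _|/negbT];
    first by rewrite mulr0 mul0r.
  rewrite -ltnNge => ltjq sys; case: dC => [dC|->]; last by rewrite mulr0 mul0r.
  have sUH : <[u]> \subset H by rewrite cycle_subG.
  apply: (IH (q.+1 - j)%N _ 'C_H[u]%G (R <*> <[u]>)%G) => //.
  - by rewrite ltn_subrL j_gt0.
  - exact: zalg_res (subsetIl _ _) ze.
  by have := resM pF pu sUH ze ze; rewrite cent_cycle ee => <-.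
rewrite Nj /n; case: ifP => [_|/negbT]; first by rewrite muln0.
rewrite -ltnNge ltnS => lejq; rewrite -ltnS (leq_trans _ szs) //= subSn //=.
by rewrite -subn1 mulnBl mul1n -expnD subnKC // ltn_subrL !expn_gt0 ltnW.
Qed.

End NonAbelian.

(** * Relative traces *)

Section Trace.

Variables (F : fieldType) (p : nat) (gT : finGroupType).
Hypothesis pF : p \in [pchar F].
Implicit Types (a b c e w z : galg F gT) (D H K P Q R : {group gT}).

Lemma galg_conj1 a : galg_conj a 1 = a.
Proof. by apply/ffunP=> x; rewrite galg_conjE invg1 conjg1. Qed.

Lemma galg_conjJ a g h : galg_conj (galg_conj a g) h = galg_conj a (g * h).
Proof. by apply/ffunP=> x; rewrite !galg_conjE invMg conjgM. Qed.

Lemma galg_conjM a b g : galg_conj (a * b) g = galg_conj a g * galg_conj b g.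
Proof.
rewrite /galg_conj -!mulrA; congr (_ * (_ * _)).
by rewrite [RHS]mulrA -geltM mulgV gelt1 mul1r.
Qed.

Definition ctrace (H K : {set gT}) a : galg F gT :=
  \sum_(C in rcosets H K) galg_conj a (repr C).

Lemma galg_conj_rcoset H a h : galg_fixed H a ->
  galg_conj a (repr (H :* h)) = galg_conj a h.
Proof.
move=> fa; have /rcosetP[x Hx ->] := mem_repr_rcoset H h.
by rewrite -galg_conjJ fa.
Qed.

(** Since [x] commutes with P, translating a coset by an element of P does not change its summand at
    [x]. *)
Lemma ctrace_fix H K P a x : galg_fixed H a -> p.-group P -> P \subset K ->
    x \in 'C(P) ->
  ctrace H K a x =
    \sum_(E in 'Fix_(rcosets H K | 'Rs)(P)) galg_conj a (repr E) x.
Proof.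
move=> fa pP sPK cPx; rewrite galg_sumE (pgroup_sum_fix pF pP (to := 'Rs%act))
  //.
  apply/actsP=> g Pg E; have Kg := subsetP sPK g Pg.
  apply/rcosetsP/rcosetsP=> -[h Kh] /=; rewrite rcosetE => defE.
    by exists (h * g^-1)%g; rewrite ?groupM ?groupV // rcosetM -defE rcosetK.
  by exists (h * g)%g; rewrite ?groupM // rcosetM defE.
move=> g E Pg /rcosetsP[h Kh ->] /=; rewrite rcosetE -rcosetM !galg_conj_rcoset
  //.
rewrite !galg_conjE invMg conjgM; congr (a (_ ^ _)%g).
by apply/conjg_fixP/commgP; apply: commuteV; apply: (centP cPx).
Qed.

Lemma rcoset_fixP H K P h : h \in K ->
  (H :* h \in 'Fix_(rcosets H K | 'Rs)(P)) = (P :^ h^-1 \subset H).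
Proof.
move=> Kh; apply/setIP/subsetP=> [[_ /afixP fx] _ /imsetP[y Py ->]|sPH].
  rewrite conjgE invgK mulgA -mem_rcoset; apply/rcoset_eqP.
  by rewrite rcosetM -[RHS](fx y Py) /= rcosetE.
split; first by apply/rcosetsP; exists h.
apply/afixP=> y Py; rewrite /= rcosetE -rcosetM; apply/rcoset_eqP.
have: (y ^ h^-1)%g \in H by rewrite sPH // memJ_conjg.
by rewrite mem_rcoset conjgE invgK mulgA.
Qed.

(** Without a coset fixed by P the sum in [ctrace_fix] would be empty, and a fixed coset [H :* h]
    puts the conjugate of P by h^-1 into H. *)
Lemma ctrace_defect H P a x : galg_fixed H a -> p.-group P ->
    x \in 'C(P) -> rel_trace H a x != 0 ->
  exists g, P :^ g \subset H.
Proof.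
move=> fa pP cPx nzx; have [E] : exists E, E \in 'Fix_(rcosets H [set: gT] |
  'Rs)(P).
  apply/set0Pn; apply: contraNneq nzx => E0.
  by rewrite -[rel_trace _ _]/(ctrace H [set: gT] a) (ctrace_fix fa pP)
    ?subsetT // E0 big_set0.
move=> FE; have /setIP[/rcosetsP[h _ defE] _] := FE.
by exists h^-1%g; rewrite -(@rcoset_fixP H [set: gT]%G P h (in_setT h)) -defE.
Qed.

(** Transitivity of the trace: the products [repr C * repr E] represent the cosets of A in K, and
    [f] ignores left factors in A. *)
Lemma sum_rcosets (V : nmodType) (A B K : {group gT}) (f : gT -> V) :
    A \subset B -> B \subset K -> (forall x y, x \in A -> f (x * y)%g = f y) ->
  \sum_(C in rcosets A K) f (repr C) =
    \sum_(E in rcosets B K) \sum_(C in rcosets A B) f (repr C * repr E)%g.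
Proof.
move=> sAB sBK fA.
have frep x : f (repr (A :* x)) = f x.
  by have /rcosetP[y Ay ->] := mem_repr_rcoset A x; apply: fA.
have BA x : (B * (A :* x) = B :* x)%g by rewrite mulgA mulGSid.
rewrite (partition_big (fun C : {set gT} => (B * C)%g) (fun E => E \in rcosets
  B K)) /=; last first.
  by move=> _ /rcosetsP[x Kx ->]; rewrite BA; apply/rcosetsP; exists x.
apply: eq_bigr => E /rcosetsP[x Kx defE]; set e := repr E.
have BeE : (B :* e = E)%g.
  by rewrite /e defE rcoset_repr.
have Ke : e \in K.
  have : e \in E by rewrite -BeE rcoset_refl.
  by rewrite defE => /rcosetP[b Bb ->]; rewrite groupM // (subsetP sBK).
rewrite (reindex_onto (fun C => C :* e) (fun C => C :* e^-1)) /=; last first.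
  by move=> C _; rewrite -!mulgA mulg_set1 mulVg mulg1.
apply: eq_big => [C|C CAB].
  rewrite -[X in _ && X]/(_ == _) [X in _ && (X == _)](_ : _ = C) ?eqxx ?andbT;
    last first.
    by rewrite -mulgA mulg_set1 mulgV mulg1.
  apply/andP/rcosetsP=> [[/rcosetsP[y Ky defC] /eqP BC]|[y By ->]].
    exists (y * e^-1)%g; last first.
      by rewrite rcosetM -defC -mulgA mulg_set1 mulgV mulg1.
    move: BC; rewrite defC BA -BeE => /rcoset_eqP.
    by rewrite mem_rcoset.
  rewrite -rcosetM BA; split.
    by apply/rcosetsP; exists (y * e)%g; rewrite // groupM // (subsetP sBK).
  by rewrite rcosetM rcoset_id // BeE.
case/andP: CAB => /andP[/rcosetsP[y Ky defC] _] _.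
have -> : C = A :* (y * e^-1).
  by rewrite rcosetM -defC -mulgA mulg_set1 mulgV mulg1.
rewrite -rcosetM mulgKV frep; have /rcosetP[a Aa ->] := mem_repr_rcoset A (y *
  e^-1).
by rewrite -mulgA fA // mulgKV.
Qed.


End Trace.

(** * Class functions as traces from a central p-subgroup *)

Section CentralTrace.

Variables (F : fieldType) (p : nat) (gT : finGroupType).
Hypothesis pF : p \in [pchar F].
Implicit Types (a b c e w z : galg F gT) (H K P Q R : {group gT}).

(** The weight of each class is put on one representative x0 and divided by |C_H(x0) : R|. Where [w]
    is nonzero, [vanish_off] forces a Sylow p-subgroup of C_H(x0) into R, so this index is
    invertible; where [w] is zero nothing has to be divided. *)
Lemma central_trace H R w : p.-group R -> R \subset 'Z(H) ->
    zalg H w -> vanish_off p H R w ->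
  exists a, supp_on H a /\ w = ctrace R H a.
Proof.
move=> pR sRZ zw vw; have sRH := subset_trans sRZ (center_sub H).
have sRC x : x \in H -> R \subset 'C_H[x].
  move=> Hx; apply/subsetP=> r /(subsetP sRZ)/setIP[Hr /centP cr].
  by rewrite inE Hr; apply/cent1P/cr.
pose a : galg F gT :=
  [ffun x => if x == repr (x ^: H) then w x / #|'C_H[x] : R|%:R else 0].
have suppa : supp_on H a by move=> x nHx; rewrite ffunE zw.1 ?mul0r ?if_same.
exists a; split=> //; apply/ffunP=> x; rewrite galg_sumE.
have [Hx|nHx] := boolP (x \in H); last first.
  rewrite zw.1 // big1 // => E /rcosetsP[h Hh defE].
  rewrite galg_conjE suppa // memJ_norm // (subsetP (normG H)) // groupV defE.
  by have /rcosetP[r Rr ->] := mem_repr_rcoset R h;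
    rewrite groupM // (subsetP sRH).
have [y Hy xy] : exists2 y, y \in H & (x ^ y)%g = repr (x ^: H).
  have /imsetP[y Hy defr] : repr (x ^: H) \in x ^: H.
    exact: mem_repr (class_refl H x).
  by exists y.
set x0 := repr (x ^: H) in xy; have Hx0 : x0 \in H by rewrite -xy groupJ.
have eqcl h : h \in H -> ((x ^ h) ^: H = x ^: H)%g by move=> Hh;
  apply: classGidl.
have cx h : h \in H -> a (x ^ h)%g = if (x ^ h)%g == x0 then w x / #|'C_H[x0] :
  R|%:R else 0.
  by move=> Hh; rewrite ffunE eqcl // -/x0; case: eqP => [->|//];
    rewrite -xy zw.2.
have cI r h : r \in R -> h \in H -> (x ^ (r * h)^-1 = x ^ h^-1)%g.
  move=> Rr Hh; rewrite invMg conjgM; apply/conjg_fixP/commgP; apply: commuteV.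
  have /setIP[_ /centP cr] := subsetP sRZ r Rr.
  by apply/commute_sym/cr; rewrite groupJ ?groupV.
transitivity (\sum_(E in rcosets R H | (x ^ (repr E)^-1)%g == x0)
                 w x / #|'C_H[x0] : R|%:R); last first.
  rewrite big_mkcondr; apply: eq_bigr => E /rcosetsP[h Hh ->].
  rewrite galg_conjE cx // groupV.
  by have /rcosetP[r Rr ->] := mem_repr_rcoset R h;
    rewrite groupM // (subsetP sRH).
rewrite sumr_const.
(* As [x ^ y = x0], these cosets are the translates by [y^-1] of the cosets of R in ['C_H[x0]]. *)
have -> : #|[pred E in rcosets R H | (x ^ (repr E)^-1)%g == x0]| = #|'C_H[x0] :
  R|.
  transitivity #|[set E :* y^-1 | E : {set gT} in rcosets R 'C_H[x0]]|.
    apply: eq_card => E; rewrite inE; apply/andP/imsetP.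
      case=> /rcosetsP[h Hh ->].
      have /rcosetP[r Rr ->] := mem_repr_rcoset R h; rewrite cI // => /eqP xh.
      exists (R :* (h * y)); last by rewrite rcosetM rcosetK.
      apply/rcosetsP; exists (h * y)%g => //; rewrite inE groupM //=.
      apply/cent1P/commute_sym/commgP/conjg_fixP;
        rewrite -[in LHS]xh -conjgM mulKg.
      exact: xy.
    case=> _ /rcosetsP[k /setIP[Hk ck] ->] ->; rewrite -rcosetM; split.
      by apply/rcosetsP; exists (k * y^-1)%g; rewrite // groupM ?groupV.
    have Hky : (k * y^-1)%g \in H by rewrite groupM ?groupV.
    have /rcosetP[r Rr ->] := mem_repr_rcoset R (k * y^-1)%g; rewrite cI //.
    rewrite invMg invgK conjgM xy; apply/eqP/conjg_fixP/commgP; apply: commuteV.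
    exact/commute_sym/cent1P.
  rewrite card_imset // => E1 E2 /(congr1 (fun E : {set gT} => E :* y)).
  by rewrite !rcosetKV.
have [->|nz_w] := eqVneq (w x) 0; first by rewrite mul0r mul0rn.
rewrite -[RHS]mulr_natr divfK // -(dvdn_pcharf pF) -(prime_coprime _
  (pcharf_prime pF)).
have [S sylS] := Sylow_exists p 'C_H[x0]; have [sSC pS p'S] := and3P sylS.
have sSR : S \subset R.
  apply/subsetP=> u Su; apply: contraR nz_w => nRu.
  have /setIP[Hu cu] := subsetP sSC u Su.
  rewrite -(zw.2 y) // xy; apply/eqP/(vw u) => //; first exact: mem_p_elt pS Su.
  by rewrite inE Hx0 cent1C.
have p'i : p^'.-nat #|'C_H[x0] : R|.
  exact: pnat_dvd (indexgS _ sSR) p'S.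
by rewrite (pnat_coprime (pnat_id (pcharf_prime pF))).
Qed.

End CentralTrace.

(** * Primitive idempotents *)

Section Local.

Variables (F : closedFieldType) (gT : finGroupType).
Implicit Types (a b c e f w x y z g : galg F gT) (H K P Q R : {group gT}).

(** The block idempotents of FH. *)
Definition prim_idem (H : {set gT}) e := [/\ zalg H e, e * e = e, e != 0 &
  forall g, zalg H g -> g * g = g -> g * e = g -> g = 0 \/ g = e].

(** Split [f] as long as it is decomposable, keeping a summand that does not annihilate [y]; the
    dimension of the left ideal FG f drops each time. *)
Lemma prim_idem_exists H f y : zalg H f -> f * f = f -> f * y != 0 ->
  exists e, [/\ prim_idem H e, e * f = e & e * y != 0].
Proof.
have [n] := ubnP (\dim (limg (amulr f))); elim: n f => // n IHn f ltfn zf ff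
  nzfy.
have [pf|npf] := pselect (prim_idem H f); first by exists f.
have [g [zg gg gf ng0 ngf]] :
    exists g, [/\ zalg H g, g * g = g, g * f = g, g <> 0 & g <> f].
  apply: contrapT => nog; apply: npf; split=> //.
    by apply: contraNneq nzfy => ->; rewrite mul0r.
  move=> g zg gg gf; apply: contrapT => /not_orP[ng0 ngf].
  by apply: nog; exists g.
have fg : f * g = g by rewrite (zalg_comm zf zg.1).
have dim_lt h : h * h = h -> h * f = h -> f * h = h -> h <> f ->
    (\dim (limg (amulr h)) < \dim (limg (amulr f)))%N.
  move=> hh hf fh nhf; rewrite ltnNge; apply/negP=> ledim.
  have sub: (limg (amulr h) <= limg (amulr f))%VS.
    apply/subvP=> _ /memv_imgP[u _ ->]; apply/memv_imgP; exists (u * h).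
      exact: memvf.
    by rewrite !lfunE /= -mulrA hf.
  have /eqP eqI : limg (amulr h) == limg (amulr f) by rewrite eqEdim sub.
  have: f \in limg (amulr h).
    rewrite eqI; apply/memv_imgP; exists 1; first exact: memvf.
    by rewrite lfunE /= mul1r.
  by case/memv_imgP=> u _; rewrite lfunE /= => defu; apply: nhf;
    rewrite -fh defu -mulrA hh.
have next h : zalg H h -> h * h = h -> h * f = h -> h <> f -> h * y != 0 ->
    exists e, [/\ prim_idem H e, e * f = e & e * y != 0].
  move=> zh hh hf nhf nzhy; have fh : f * h = h by rewrite (zalg_comm zf zh.1).
  have lth : (\dim (limg (amulr h)) < n)%N.
    by apply: leq_trans (dim_lt _ hh hf fh nhf) _; rewrite -ltnS.
  by have [e [pe eh ey]] := IHn h lth zh hh nzhy; exists e; split;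
    rewrite // -eh -mulrA hf.
have [gy0|] := eqVneq (g * y) 0; last exact: next.
apply: (next (f - g)).
- exact: zalgB.
- by rewrite mulrBl !mulrBr ff fg gf gg subrr subr0.
- by rewrite mulrBl ff gf.
- by move/eqP; rewrite -subr_eq0 addrAC subrr sub0r oppr_eq0 => /eqP.
by rewrite mulrBl gy0 subr0.
Qed.

Lemma alg_dependent (A : falgType F) (x : A) :
  exists2 P : {poly F}, P != 0 & horner_alg x P = 0.
Proof.
pose n := (\dim {:A}).+1; pose X := [tuple x ^+ i | i < n].
have nfX : ~~ free X.
  rewrite /free (contraTneq _ (ltnSn (\dim {:A}))) // => dX; rewrite -leqNgt.
  by rewrite -[_.+1](size_tuple X) -dX dimvS ?subvf.
have [k [sk [i nzi]]] : exists k : 'I_n -> F,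
    \sum_(i < n) k i *: x ^+ i = 0 /\ exists i, k i != 0.
  apply: contrapT => nok; case/negP: nfX; apply/freeP=> k sk i.
  apply/eqP/negPn/negP=> nzi; apply: nok; exists k; split; last by exists i.
  by rewrite -[RHS]sk; apply: eq_bigr => j _; rewrite -tnth_nth tnth_mktuple.
exists (\sum_(i < n) k i *: 'X^i).
  apply/eqP=> /(congr1 (fun P : {poly F} => P`_i)).
  rewrite coef0 coef_sum (bigD1 i) //= coefZ coefXn eqxx mulr1 big1 ?addr0.
    by move/eqP; rewrite (negPf nzi).
  by move=> j ne; rewrite coefZ coefXn eq_sym (inj_eq val_inj) (negPf ne) mulr0.
rewrite -[RHS]sk raddf_sum; apply: eq_bigr => j _.
by rewrite /= -mul_polyC rmorphM /= rmorphXn /= horner_algC horner_algX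
  mulr_algl.
Qed.

Lemma zalg_horner H x (P : {poly F}) : zalg H x -> zalg H (horner_alg x P).
Proof.
move=> zx; elim/poly_ind: P => [|P c IHP]; first by rewrite rmorph0;
  apply: zalg0.
rewrite rmorphD rmorphM /= horner_algX horner_algC.
by apply: zalgD (zalgM IHP zx) (zalgZ _ (zalg1 _ _)).
Qed.

(** Fitting decomposition: an annihilating polynomial of [y] gives y^k = y^(k+1) b with b a
    polynomial in [y]. Then y^k b^k is idempotent, and its product with the primitive [e] is 0 or
    [e]: the nilpotent and the invertible case. *)
Lemma prim_idem_fitting H e y : prim_idem H e -> zalg H y ->
  (exists n, y ^+ n * e = 0) \/ (exists2 b, zalg H b & b * y * e = e).
Proof.
move=> [ze ee nze pe] zy; have [P nzP P0] := alg_dependent y.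
have [k [b zb yk]] : exists k, exists2 b, zalg H b & y ^+ k = y ^+ k.+1 * b.
  have [k [Q]] := multiplicity_XsubC P 0; rewrite nzP /= => nQ0 defP.
  have [R [c defQ]] : exists (R : {poly F}) (c : F), Q = R * 'X + c%:P.
    by elim/poly_ind: (Q) => [|R c _]; [exists 0, 0;
      rewrite mul0r add0r | exists R, c].
  have nzc : c != 0 by move: nQ0; rewrite defQ rootE !hornerE ?mulr0 ?add0r.
  exists k, (- c^-1 *: horner_alg y R); first exact: zalgZ (zalg_horner _ zy).
  move: P0; rewrite defP subr0 defQ rmorphM rmorphXn rmorphD rmorphM /=
    horner_algX.
  rewrite horner_algC mulrDl; move/eqP; rewrite addrC addr_eq0 -scalerAl mul1r
    => /eqP yk.
  rewrite -[LHS]scale1r -(mulVf nzc) -scalerA yk -scalerAr scalerN scaleNr.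
  by rewrite -mulrA -exprS (zalg_comm (zalgX _ zy) (zalg_horner R zy).1).
have cyb : y * b = b * y := zalg_comm zy zb.1.
have yX n : y ^+ k = y ^+ (k + n) * b ^+ n.
  elim: n => [|n IHn]; first by rewrite addn0 mulr1.
  rewrite addnS -addSn addnC exprD [b ^+ _]exprS mulrA -(mulrA _ _ b) -yk.
  by rewrite -exprD addnC -IHn.
have comm (u v : galg F gT) : zalg H u -> zalg H v -> u * v = v * u.
  by move=> zu [sv _]; apply: zalg_comm zu sv.
have zyX n := zalgX n zy; have zbX n := zalgX n zb.
pose h := y ^+ k * b ^+ k; have zh : zalg H h by apply: zalgM.
have ykh : y ^+ k * h = y ^+ k by rewrite /h mulrA -exprD -yX.
have hh : h * h = h by rewrite {1}/h -mulrA (comm (b ^+ k)) // mulrA ykh.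
have zg : zalg H (h * e) by apply: zalgM.
have gg : h * e * (h * e) = h * e.
  by rewrite mulrA -(mulrA h e h) (comm e) // mulrA hh -mulrA ee.
case: (pe _ zg gg); first by rewrite -mulrA ee.
  by move=> g0; left; exists k; rewrite -ykh -mulrA g0 mulr0.
move=> ge; right; exists (y ^+ k * b ^+ k.+1); first exact: zalgM.
rewrite -[RHS]ge /h {2}yk -(mulrA _ _ y) (comm _ y) // mulrA -exprSr.
by rewrite [b ^+ _]exprS mulrA.
Qed.


(** An annihilating polynomial splits over the closed field. By Fitting, a linear factor is
    nilpotent or invertible on [e], and an invertible one can be cancelled. *)
Lemma prim_idem_local H e x : prim_idem H e -> zalg H x ->
  exists (c : F) n, (x - c%:A) ^+ n * e = 0.
Proof.
move=> pe zx; have [ze _ nze _] := pe.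
have [P nzP P0] := alg_dependent x.
have {P0}: horner_alg x P * e = 0 by rewrite P0 mul0r.
have [n] := ubnP (size P); elim: n P nzP => // n IHn P nzP;
  rewrite ltnS => szP Pe0.
have [sP1|/closed_rootP[c]] := eqVneq (size P) 1%N.
  have /size_poly1P[k nzk defP] : size P == 1%N by apply/eqP.
  move: Pe0; rewrite defP horner_algC mulr_algl => /eqP.
  by rewrite scaler_eq0 (negPf nzk) (negPf nze).
case/factor_theorem=> Q defP; have nzQ : Q != 0.
  by apply: contraNneq nzP => Q0; rewrite defP Q0 mul0r.
have zy : zalg H (x - c%:A) by apply: zalgB zx (zalgZ _ (zalg1 _ _)).
have hy : horner_alg x ('X - c%:P) = x - c%:A.
  by rewrite rmorphB /= horner_algX horner_algC.
have [[m ym]|[b zb bye]] := prim_idem_fitting pe zy; first by exists c, m.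
apply: (IHn Q nzQ).
  by apply: leq_trans szP; rewrite defP size_Mmonic ?monicXsubC // size_XsubC
    addn2.
have Qye : horner_alg x Q * (x - c%:A) * e = 0 by rewrite -hy -rmorphM -defP.
have cQb := zalg_comm (zalg_horner Q zx) zb.1.
by rewrite -bye mulrA mulrA cQb -!mulrA [_ * (_ * e)]mulrA Qye mulr0.
Qed.

End Local.

(** * Blocks with central defect group *)

Section CentralBlock.

Variables (F : closedFieldType) (p : nat) (gT : finGroupType).
Hypothesis pF : p \in [pchar F].
Implicit Types (a b e f n w x y z g : galg F gT) (r t u : gT).
Variables (H R : {group gT}) (f0 : galg F gT).
Hypotheses (pR : p.-group R) (sRZ : R \subset 'Z(H)).
Hypotheses (pf0 : prim_idem H f0) (vf0 : vanish_off p H R f0).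

Let sRH : R \subset H := subset_trans sRZ (center_sub H).
Let abR : abelian R := abelianS sRZ (center_abelian H).
Let zf0 : zalg H f0. Proof. by case: pf0. Qed.
Let ff0 : f0 * f0 = f0. Proof. by case: pf0. Qed.

Let cR r u : r \in R -> u \in H -> commute r u.
Proof. by move=> /(subsetP sRZ)/setIP[_ /centP cr] /cr. Qed.

Let cRg r y : r \in R -> zalg H y -> gelt F r * y = y * gelt F r.
Proof.
move=> Rr zy; rewrite (zalg_comm zy) //; apply: supp_on_gelt.
exact: (subsetP sRH).
Qed.

(** An element where [n] is nonzero has its p-part in R. Cutting [n] according to this p-part and
    shifting to p-regular elements gives slices [m r] for which [n] is the sum of the
    [gelt F r * m r]. The condition on [n * sumg F R] says that the slices sum to zero, so r may be
    replaced by r - 1. *)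
Lemma augmentation_split n : zalg H n -> vanish_off p H R n -> n * sumg F R = 0
  ->
  exists m : gT -> galg F gT, (forall r, r \in R -> zalg H (m r)) /\
    n = \sum_(r in R) (gelt F r - 1) * m r.
Proof.
move=> zn vn nR0.
pose m r : galg F gT := [ffun u => if (u.`_p == 1)%g then n (r * u)%g else 0].
have sm : \sum_(r in R) m r = 0.
  apply/ffunP=> u; rewrite galg_sumE galg_0E; under eq_bigr do rewrite ffunE.
  have [_|_] := boolP (u.`_p == 1)%g; last by rewrite big1.
  rewrite -[RHS](galg_0E F u) -nR0 -(zalg_comm (zalg_sumg F sRZ) zn.1)
    galg_mulE.
  rewrite [RHS](reindex_inj invg_inj) [RHS](bigID (mem R)) /= [X in _ = _ +
    X]big1 ?addr0.
    by apply: eq_bigr => r Rr; rewrite sumgE groupV Rr mul1r invgK.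
  by move=> r nRr; rewrite sumgE groupV (negPf nRr) mul0r.
have sgm : \sum_(r in R) gelt F r * m r = n.
  apply/ffunP=> u; rewrite galg_sumE.
  under eq_bigr do rewrite gelt_mulE ffunE mulKVg.
  have [Hu|nHu] := boolP (u \in H); last by rewrite zn.1 // big1 // => *;
    rewrite if_same.
  have upr r : r \in R -> ((r^-1 * u).`_p == 1)%g = (r == u.`_p)%g.
    move=> Rr; rewrite consttM; last first.
      exact/commute_sym/commuteV/commute_sym/cR.
    rewrite [(r^-1).`_p]constt_p_elt ?p_eltV ?(mem_p_elt pR) //.
    by rewrite -eq_mulVg1.
  have [Rup|nRup] := boolP ((u.`_p)%g \in R).
    rewrite (bigD1 u.`_p) //= upr // eqxx big1 ?addr0 // => r /andP[Rr ne].
    by rewrite upr // (negPf ne).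
  have -> : n u = 0; last by rewrite big1 // => *; rewrite if_same.
  apply: (vn (u.`_p)%g) => //; first exact: groupX.
    exact: p_elt_constt.
  by apply/setIP; split=> //; apply/cent1P; apply: commuteX.
exists m; split=> [r Rr|]; last first.
  transitivity (\sum_(r in R) gelt F r * m r - \sum_(r in R) m r).
    by rewrite sm subr0 sgm.
  rewrite -sumrB.
  by apply: eq_bigr => r _; rewrite mulrBl mul1r.
split=> [u nHu|h u Hh]; rewrite !ffunE.
  by rewrite zn.1 ?if_same // groupMl // (subsetP sRH).
rewrite consttJ -[X in _ == X](conj1g h) (inj_eq (conjg_inj h)).
case: ifP => // _; rewrite -[in RHS](zn.2 h) // conjMg; congr (n (_ * _)%g).
by apply/esym/conjg_fixP/commgP/cR.
Qed.

Let M y := zalg H y /\ y * f0 = y.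

(* The filtration of the ideal M of zalg H generated by f0 by the powers of the
   augmentation ideal of FR; Nakayama's lemma is applied to FR * f0. *)
Fixpoint depth k y : Prop :=
  if k is k'.+1 then
    exists m : gT -> galg F gT, (forall r, r \in R -> depth k' (m r)) /\
      y = \sum_(r in R) (gelt F r - 1) * m r
  else M y.

(** Unfolding the depth produces further factors r - 1, and |R| of these annihilate whatever
    commutes with R. In particular depth |R| forces zero. *)
Lemma depth_kill k y rs : depth k y -> (forall r, r \in rs -> r \in R) ->
  (#|R| <= size rs + k)%N -> \prod_(r <- rs) (gelt F r - 1) * y = 0.
Proof.
elim: k y rs => [|k IHk] y rs.
  move=> [zy _] Rrs; rewrite addn0 => szrs.
  rewrite -(big_map (fun r => gelt F r - 1) xpredT id) /=.
  apply: (@kill_descend F p gT pF R (fun z => exists2 r, r \in R & z = gelt F r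
    - 1)
    (fun b => forall r, r \in R -> gelt F r * b = b * gelt F r)) => //.
  - move=> _ b [r Rr ->] cb u Ru.
    rewrite mulrBl mul1r mulrBr mulrBl mulrA -geltM (centsP abR u Ru r Rr)
      geltM.
    by rewrite -!mulrA cb.
  - move=> r b Rr cb u Ru; rewrite mulrA cb // -!mulrA; congr (_ * _).
    by rewrite mulrBl mulrBr mul1r mulr1 -!geltM (centsP abR u Ru r Rr).
  - by move=> _ b [r Rr ->] cb Rb; rewrite mulrBl mul1r cb // Rb // subrr.
  - by move=> r Rr; apply: cRg.
  - by move=> _ /mapP[r /Rrs Rr ->]; exists r.
  by rewrite size_map.
case=> m [dm ->] Rrs szrs; rewrite mulr_sumr big1 // => r Rr.
rewrite mulrA; have := IHk (m r) (rcons rs r) (dm r Rr).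
rewrite -cats1 big_cat big_seq1 => -> //; last by rewrite size_cat addn1
  addSnnS.
by move=> u; rewrite mem_cat inE => /orP[/Rrs|/eqP->].
Qed.

Lemma depth1 y : M y -> y * sumg F R = 0 -> depth 1 y.
Proof.
move=> [zy yf] yR; have vy : vanish_off p H R y by rewrite -yf;
  apply: (vanish_offM pF).
have [m [zm defy]] := augmentation_split zy vy yR.
exists (fun r => m r * f0); split=> [r Rr|].
  by split; [apply: zalgM (zm r Rr) zf0 | rewrite -mulrA ff0].
by rewrite -yf {1}defy mulr_suml; apply: eq_bigr => r _; rewrite mulrA.
Qed.

(** At depth 0, locality gives a scalar c for which y - c f0 is nilpotent. Since [f0 * sumg F R] is
    R-fixed, [central_inv_kill] makes this difference annihilate it, which is the criterion for
    depth 1. At greater depth the coefficients are corrected recursively. *)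
Lemma depth_lift k y : depth k y ->
  exists a, supp_on R a /\ depth k.+1 (y - a * f0).
Proof.
elim: k y => [|k IHk] y.
  move=> [zy yf]; have [c [k yk]] := prim_idem_local pf0 zy.
  exists c%:A; split=> [u nRu|].
    by rewrite galg_scaleE galg_1E; case: eqP nRu => [->|_ _];
      rewrite ?group1 ?mulr0.
  have zn : zalg H (y - c%:A * f0).
    by apply: zalgB zy (zalgM (zalgZ _ (zalg1 _ _)) zf0).
  have nf : (y - c%:A * f0) * f0 = y - c%:A * f0 by rewrite mulrBl yf -mulrA
    ff0.
  apply: depth1; first by split.
  have defn : y - c%:A * f0 = (y - c%:A) * f0 by rewrite mulrBl yf.
  have zRf := zalgM zf0 (zalg_sumg F sRZ).
  rewrite -nf -mulrA; apply: (central_inv_kill pF sRZ _ zRf).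
  - split=> //; exists k.+1; rewrite defn exprMn_comm; last first.
      by apply: zalg_comm zf0.1; apply: zalgB zy (zalgZ _ (zalg1 _ _)).
    have -> : f0 ^+ k.+1 = f0 by elim: (k) => // i IHi; rewrite exprS IHi.
    by rewrite exprS -mulrA yk mulr0.
  - by rewrite (zalg_comm zf0 (zalg_sumg F sRZ).1);
    apply: (vanish_offM pF) (zalg_sumg F sRZ) zf0 vf0.
  by move=> r Rr; rewrite -mulrA sumg_gelt.
case=> m [dm ->]; have [a aP] : exists a : gT -> galg F gT, forall r, r \in R
  -> supp_on R (a r) /\
    depth k.+1 (m r - a r * f0).
  have ex r : exists a, r \in R -> supp_on R a /\ depth k.+1 (m r - a * f0).
    have [Rr|nRr] := boolP (r \in R); last by exists 0.
    by have [a aP] := IHk _ (dm r Rr); exists a.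
  by have [a aP] := choice ex; exists a.
exists (\sum_(r in R) (gelt F r - 1) * a r); split.
  move=> u nRu; rewrite galg_sumE big1 // => r Rr.
  rewrite mulrBl mul1r galg_subE gelt_mulE !(aP r Rr).1 ?subrr //.
  by rewrite groupMl ?groupV.
exists (fun r => m r - a r * f0); split=> [r Rr|]; first by case: (aP r Rr).
by rewrite mulr_suml -sumrB; apply: eq_bigr => r _; rewrite -mulrA -mulrBr.
Qed.

(** Corrections by [depth_lift] raise the depth one by one, and at depth |R| the remainder is
    zero. *)
Lemma block_center_coef y : zalg H y -> y * f0 = y ->
  exists a, supp_on R a /\ y = a * f0.
Proof.
move=> zy yf; have dep k : exists a, supp_on R a /\ depth k (y - a * f0).
  elim: k => [|k [a [sa dk]]].
    by exists 0; rewrite mul0r subr0; split=> // u _; rewrite galg_0E.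
  have [b [sb dk1]] := depth_lift dk; exists (a + b); split.
    by move=> u nRu; rewrite galg_addE sa ?sb ?addr0.
  by rewrite mulrDl opprD addrA.
have [a [sa dR]] := dep #|R|; exists a; split=> //; apply/eqP.
rewrite -subr_eq0; apply/eqP; have := depth_kill (rs := [::]) dR.
by rewrite big_nil mul1r; apply.
Qed.

(** Otherwise [f0] has depth 1, so by multiplication every element of its ideal has every depth and
    vanishes. *)
Lemma sumg_block_neq0 : sumg F R * f0 != 0.
Proof.
apply/eqP=> Rf0.
have fR0 : f0 * sumg F R = 0 by rewrite (zalg_comm zf0 (zalg_sumg F sRZ).1).
have [m [dm deff]] := depth1 (conj zf0 ff0) fR0.
have dep k y : M y -> depth k y.
  elim: k y => // k IHk y [zy yf].
  exists (fun r => m r * y); split=> [r Rr|].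
    apply: IHk; have [zm _] := dm r Rr; split; first exact: zalgM.
    by rewrite -mulrA yf.
  rewrite -[LHS]yf (zalg_comm zy zf0.1) {1}deff mulr_suml.
  by apply: eq_bigr => r _; rewrite mulrA.
have := depth_kill (rs := [::]) (dep #|R| f0 (conj zf0 ff0)).
by rewrite big_nil mul1r => f00; case: pf0 => _ _ /eqP[]; apply: f00.
Qed.

(** The annihilator of [f0] in FR is an ideal. If nonzero, it contains a nonzero R-fixed element,
    that is a multiple of [sumg F R], against [sumg_block_neq0]. *)
Lemma block_coef_inj a : supp_on R a -> a * f0 = 0 -> a = 0.
Proof.
move=> sa af0; apply: contrapT => nza.
have cR1 (b : galg F gT) r : supp_on R b -> r \in R -> b * gelt F r = gelt F r
  * b.
  move=> sb Rr; apply/ffunP=> u; rewrite mul_geltE gelt_mulE.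
  have [Ru|nRu] := boolP (u \in R).
    by rewrite (centsP abR u Ru r^-1%g) ?groupV.
  have Rr1 : (r^-1)%g \in R by rewrite groupV.
  by rewrite !sb ?(groupMr u Rr1) ?(groupMl u Rr1).
have sR1 b r : supp_on R b -> r \in R -> supp_on R ((gelt F r - 1) * b).
  move=> sb Rr u nRu; rewrite mulrBl mul1r galg_subE gelt_mulE !sb ?subrr //.
  by rewrite groupMl ?groupV.
have [b [sb bf0 nzb Rb]] : exists b, [/\ supp_on R b, b * f0 = 0, b <> 0 &
    forall r, r \in R -> gelt F r * b = b].
  apply: contrapT => nob.
  have step b : supp_on R b -> b * f0 = 0 -> b <> 0 ->
      exists2 r, r \in R & (gelt F r - 1) * b <> 0.
    move=> sb bf0 nzb; apply: contrapT => nor; apply: nob; exists b;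
      split=> // r Rr.
    apply/eqP; rewrite -subr_eq0 -[X in _ - X]mul1r -mulrBl; apply/eqP.
    by apply: contrapT => nzr; apply: nor; exists r.
  have long k : exists rs, [/\ size rs = k, (forall r, r \in rs -> r \in R),
      supp_on R (\prod_(r <- rs) (gelt F r - 1) * a),
      \prod_(r <- rs) (gelt F r - 1) * a * f0 = 0
      & \prod_(r <- rs) (gelt F r - 1) * a <> 0].
    elim: k => [|k [rs [szrs Rrs srs rsf nzrs]]].
      by exists [::]; split; rewrite // big_nil mul1r.
    have [r Rr nzr] := step _ srs rsf nzrs; exists (r :: rs).
    split; rewrite ?big_cons -?[(_ * _ * a)]mulrA //; first by rewrite /= szrs.
    - by move=> u; rewrite inE => /orP[/eqP->|/Rrs].
    - exact: sR1.
    by rewrite -mulrA rsf mulr0.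
  have [rs [szrs Rrs _ _ []]] := long #|R|.
  rewrite -(big_map (fun r => gelt F r - 1) xpredT id) /=.
  apply: (@kill_descend F p gT pF R (fun z => exists2 r, r \in R & z = gelt F r
    - 1)
    (fun b => supp_on R b)) => //.
  - by move=> _ b [r Rr ->] sb; apply: sR1.
  - by move=> r b Rr sb; rewrite mulrBr mulr1 cR1 // -{2}[b]mul1r -mulrBl;
    apply: sR1.
  - by move=> _ b [r Rr ->] sb Rb; rewrite mulrBl mul1r -cR1 // Rb // subrr.
  - by move=> _ /mapP[r /Rrs Rr ->]; exists r.
  by rewrite size_map szrs.
have defb : b = b 1%g *: sumg F R.
  apply/ffunP=> u; rewrite galg_scaleE sumgE;
    have [Ru|/sb->] := boolP (u \in R).
    by rewrite mulr1 -[in LHS](Rb u Ru) gelt_mulE mulVg.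
  by rewrite mulr0.
have nzb1 : b 1%g != 0.
  by apply/eqP=> b10; apply: nzb; rewrite defb b10 scale0r.
have := sumg_block_neq0; case/negP; move/eqP: bf0.
by rewrite defb -scalerAl scaler_eq0 (negPf nzb1).
Qed.

End CentralBlock.

(** Y is C_R(t)[R,t]. If it were all of R, then [R,t] = [[R,t],t], which is impossible in the
    nilpotent group R<t> because [R,t] is nontrivial. *)
Lemma moved_subgroup (p : nat) (gT : finGroupType) (R : {group gT}) t :
    prime p -> p.-group R -> abelian R -> t \in 'N(R) -> p.-elt t -> t \notin
      'C(R) ->
  exists Y : {group gT}, [/\ Y \subset R, Y \proper R, (#|Y| <= #|R| %/ p)%N,
    'C_R[t] \subset Y & forall x, x \in R -> [~ x, t] \in Y].
Proof.
move=> p_pr pR abR nRt pt ncRt; set T := <[t]>%G.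
have nRT : T \subset 'N(R) by rewrite cycle_subG.
have sKR : [~: R, T] \subset R by rewrite commg_subl.
pose Y := ('C_R[t] <*> [~: R, T])%G.
have sYR : Y \subset R by rewrite join_subG subsetIl.
have pY : Y \proper R.
  rewrite properE sYR; apply/negP=> sRY.
  have pP : p.-group (R <*> T).
    by rewrite norm_joinEr // pgroupM pR.
  have nilP := pgroup_nil pP.
  have cKC : [~: R, T] \subset 'C('C_R[t]).
    by apply: subset_trans sKR _; apply: subset_trans abR (centS (subsetIl _
      _)).
  have defR : R :=: ('C_R[t] * [~: R, T])%g.
    by apply/eqP; rewrite -cent_joinEr // eqEsubset sRY.
  have ntK : [~: R, T] != 1%g.
    by apply: contra ncRt => /eqP/commG1P; rewrite centsC cycle_subG.
  have nKT : T \subset 'N([~: R, T]).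
    exact: commg_normr.
  have sKP : [~: R, T] \subset R <*> T := subset_trans sKR (joing_subl _ _).
  have := nil_comm_properl nilP sKP ntK (A := T).
  rewrite subsetI joing_subr nKT => /(_ isT);
    rewrite properE => /andP[_ /negP[]].
  rewrite gen_subG; apply/subsetP=> _ /imset2P[x s Rx Ts ->].
  move: Rx; rewrite {1}defR => /mulsgP[c k /setIP[_ ct] Kk ->].
  rewrite commMgJ (_ : [~ c, s] = 1)%g ?conj1g ?mul1g ?mem_commg //.
  apply/eqP/commgP; case/cycleP: Ts => i ->; apply: commuteX; exact/cent1P.
exists Y; split=> //.
- have [[|k] defI] : {k | #|R : Y| = (p ^ k)%N}.
  + by apply/p_natP/(pnat_dvd (dvdn_indexg _ _)).
  + by case/proper_subn/negP: pY; rewrite -indexg_eq1 defI.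
  rewrite leq_divRL ?prime_gt0 // -(Lagrange sYR) defI leq_mul //.
  by rewrite expnS leq_pmulr // expn_gt0 prime_gt0.
- exact: joing_subl.
by move=> x Rx; rewrite mem_gen // inE mem_commg ?orbT // cycle_id.
Qed.

(** * Fusion on an abelian defect group *)

Section FusionKill.

Variables (F : closedFieldType) (p : nat) (gT : finGroupType).
Hypothesis pF : p \in [pchar F].
Implicit Types (a b e f n w x y z g : galg F gT) (H R Y : {group gT}).

Lemma coset_sum_eq0 R Y a (t : gT) (x : gT) :
    supp_on R a -> (forall u, a (u ^ t)%g = a u) -> p.-elt t ->
    t \in 'N(R) -> Y \subset R -> 'C_R[t] \subset Y -> (forall u, u \in R -> [~
      u, t] \in Y) ->
    x \in R -> x \notin Y ->
  (a * sumg F Y) x = 0.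
Proof.
move=> sa at_ pt nRt sYR sCY sKY Rx nYx.
have Yt u : u \in Y -> (u ^ t)%g \in Y.
  by move=> Yu; rewrite -(mulKVg u (u ^ t)%g) groupM // sKY // (subsetP sYR).
have -> : (a * sumg F Y) x = \sum_(u in (x *: Y)%g) a u.
  rewrite galg_mulE [RHS]big_mkcond; apply: eq_bigr => u _.
  rewrite sumgE mem_lcoset -groupV invMg invgK.
  by case: (_ \in Y); rewrite ?mulr1 ?mulr0.
rewrite (pgroup_sum_fix pF (P := <[t]>%G) (to := 'J%act)) //.
- rewrite big1 // => u /setIP[/lcosetP[y Yy ->]];
  rewrite afixJ cent_cycle => ct.
  case/negP: nYx; have: (x * y)%g \in Y.
    by apply: (subsetP sCY); rewrite inE groupM // (subsetP sYR).
  by rewrite groupMr.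
- rewrite cycle_subG; apply/astabsP=> u /=.
  have [Ru|nRu] := boolP (u \in R).
    by rewrite !mem_lcoset -(mulKVg u (u ^ t)%g) mulgA groupMr ?sKY.
  have sxR : (x *: Y)%g \subset R by apply/subsetP=> _ /lcosetP[y /(subsetP
    sYR) Ry ->]; rewrite groupM.
  rewrite !(contraNF (subsetP sxR _)) // memJ_norm //.
by move=> _ u /cycleP[k ->] _ /=; elim: k => [|k IHk];
  rewrite ?conjg1 // expgSr conjgM at_.
Qed.

(* Each z acts on f0 as a t-fixed nilpotent element of FR.  Such an element
   kills all Y-invariants when Y is a proper subgroup containing C_R(t) and
   [R, t], for t then permutes every coset of Y other than Y itself without
   fixed points. *)
Lemma fusion_kill H R f0 (t : gT) zs :
    p.-group R -> R \subset 'Z(H) -> prim_idem H f0 -> vanish_off p H R f0 ->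
    t \in 'N(R) -> p.-elt t -> t \notin 'C(R) -> galg_conj f0 t = f0 ->
    (forall z, z \in zs -> nilcent H z /\ galg_conj z t = z) ->
    (#|R| %/ p <= size zs)%N ->
  \prod_(z <- zs) z * f0 = 0.
Proof.
move=> pR sRZ pf0 vf0 nRt pt ncRt f0t zzs szs.
have abR : abelian R := abelianS sRZ (center_abelian H).
have [zf0 ff0 _ _] := pf0.
have sRH : R \subset H := subset_trans sRZ (center_sub H).
have [Y [sYR pY cardY sCY sKY]] :=
  moved_subgroup (pcharf_prime pF) pR abR nRt pt ncRt.
have cRg r y : r \in R -> zalg H y -> gelt F r * y = y * gelt F r.
  move=> Rr zy; rewrite (zalg_comm zy) //; apply: supp_on_gelt.
  exact: (subsetP sRH).
have zR (a : galg F gT) : supp_on R a -> zalg R a.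
  move=> sa; split=> // h x Rh; have [Rx|nRx] := boolP (x \in R).
    by rewrite (conjg_fixP _) //; apply/commgP/(centsP abR).
  by rewrite !sa // memJ_norm // (subsetP (normG R)).
pose O a := supp_on R a /\ a * sumg F Y = 0.
have coef z : z \in zs -> exists2 a, O a & z * f0 = a * f0.
  move=> /zzs[[zz [k zk0]] zt].
  have [a [sa zfa]] := block_center_coef pF pR sRZ pf0 vf0 (zalgM zz zf0)
     (etrans (esym (mulrA _ _ _)) (congr1 _ ff0)).
  exists a => //; split=> //.
  (* The coefficient [a] is unique by [block_coef_inj], so it inherits invariance under [t] and,
     below, nilpotency from [z]. *)
  have at_ : galg_conj a t = a.
    apply/eqP; rewrite -subr_eq0; apply/eqP.
    apply: (block_coef_inj pF pR sRZ pf0 vf0).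
      move=> u nRu; rewrite galg_subE galg_conjE !sa ?subrr //.
      by rewrite memJ_norm // groupV.
    by rewrite mulrBl -{1}f0t -galg_conjM -zfa galg_conjM zt f0t subrr.
  have zk1 : z ^+ k.+1 = 0 by rewrite exprS zk0 mulr0.
  have caf : GRing.comm a f0.
    apply/esym/(zalg_comm zf0) => u nHu; apply: sa.
    by apply: contra nHu; apply: (subsetP sRH).
  have fk : f0 ^+ k.+1 = f0 by elim: (k) => // i IHi; rewrite exprS IHi.
  have ak0 : a ^+ k.+1 = 0.
    apply: (block_coef_inj pF pR sRZ pf0 vf0);
      first by case: (zalgX k.+1 (zR a sa)).
    rewrite -[f0]fk -exprMn_comm // -zfa exprMn_comm ?zk1 ?mul0r //.
    exact: zalg_comm zz zf0.1.
  have atE u : a (u ^ t)%g = a u by rewrite -{1}at_ galg_conjE conjgK.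
  have sY : supp_on R (sumg F Y).
    by move=> u nRu; rewrite sumgE; case: (boolP (u \in Y)) nRu => // /(subsetP
      sYR)->.
  (* The product vanishes outside Y, so [sumg F Y] is an eigenvector of [a], and nilpotency makes
     the eigenvalue zero. *)
  have defaY : a * sumg F Y = (a * sumg F Y) 1%g *: sumg F Y.
    apply/ffunP=> u; rewrite galg_scaleE sumgE.
    have [Yu|nYu] := boolP (u \in Y).
      by rewrite mulr1 -[in LHS](sumg_gelt F Yu) mulrA mul_geltE mulgV.
    rewrite mulr0; have [Ru|nRu] := boolP (u \in R).
      exact: (coset_sum_eq0 sa atE pt nRt sYR sCY sKY Ru nYu).
    exact: supp_onM sa sY u nRu.
  rewrite defaY; set c := _ 1%g in defaY *.
  have akY i : a ^+ i * sumg F Y = c ^+ i *: sumg F Y.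
    elim: i => [|i IHi]; first by rewrite mul1r scale1r.
    by rewrite exprSr -mulrA defaY -scalerAr IHi scalerA exprS.
  have /esym/eqP := akY k.+1; rewrite ak0 mul0r scaler_eq0 expf_eq0 /=.
  by case/orP=> /eqP-> ; rewrite ?scale0r ?scaler0.
have {coef}[g gP] : exists g : galg F gT -> galg F gT, forall z, z \in zs ->
    O (g z) /\ z * f0 = g z * f0.
  have ex z : exists a, z \in zs -> O a /\ z * f0 = a * f0.
    have [zin|nzin] := boolP (z \in zs); last by exists 0.
    by have [a Oa za] := coef z zin; exists a.
  by have [g gP] := choice ex; exists g.
have -> : \prod_(z <- zs) z * f0 = \prod_(a <- map g zs) a * f0.
  have sR s : (forall z, z \in s -> z \in zs) -> zalg R (\prod_(a <- map g s)
    a).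
    by move=> ss; apply: zalg_prod => _ /mapP[z /ss/gP[[sa _] _] ->]; apply: zR.
  suff main s : (forall z, z \in s -> z \in zs) ->
     \prod_(z <- s) z * f0 = \prod_(a <- map g s) a * f0 by apply: main.
  elim: s => [|z s IHs] ss; first by rewrite !big_nil.
  have ss' y : y \in s -> y \in zs by move=> sy; apply: ss; rewrite inE sy orbT.
  have [[sa _] za] := gP z (ss z (mem_head _ _));
    have [[zz _] _] := zzs z (ss z (mem_head _ _)).
  rewrite /= !big_cons -mulrA IHs // mulrA (zalg_comm zz); last first.
    move=> u nHu; have [sp _] := sR s ss'; apply: sp.
    by apply: contra nHu; apply: (subsetP sRH).
  by rewrite -mulrA za mulrA (zalg_comm (sR s ss') sa) .
apply: (@kill_descend F p gT pF Y O (fun b => forall r, r \in R -> gelt F r * b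
  = b * gelt F r)).
- exact: pgroupS sYR pR.
- exact: abelianS sYR abR.
- move=> a b [sa _] cb r Rr; rewrite mulrA.
  rewrite -(zalg_comm (zR a sa)); last exact: supp_on_gelt.
  by rewrite -!mulrA cb.
- move=> r b /(subsetP sYR) Rr cb u Ru; rewrite mulrA cb // -!mulrA;
  congr (_ * _).
  by rewrite mulrBl mulrBr mul1r mulr1 -!geltM (centsP abR u Ru r Rr).
- move=> a b [sa aY] cb Yb.
  have [r Yr|c ->] := @inv_factor _ _ Y b; first by rewrite cb ?Yb // (subsetP
    sYR).
  by rewrite mulrA aY mul0r.
- by move=> r Rr; apply: cRg.
- by move=> _ /mapP[z /gP[Oz _] ->].
by rewrite size_map (leq_trans cardY).
Qed.

End FusionKill.

(** * Relative traces and the stabiliser of a block of C(R) *)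

Section Stable.

Variables (F : closedFieldType) (p : nat) (gT : finGroupType).
Hypothesis pF : p \in [pchar F].
Implicit Types (a b e f n w x y z g : galg F gT) (H D R P : {group gT}).
Local Notation G := [set: gT]%G.

Lemma res_centM P a b : p.-group P -> zalg G a -> zalg G b ->
  res 'C(P) (a * b) = res 'C(P) a * res 'C(P) b.
Proof. by move=> pP za zb; rewrite -(setTI 'C(P)) (resM pF) // subsetT. Qed.

Lemma res_centX P a k : p.-group P -> zalg G a ->
  res 'C(P) (a ^+ k) = res 'C(P) a ^+ k.
Proof. by move=> pP za; rewrite -(setTI 'C(P)) (resX pF) // subsetT. Qed.

Lemma galg_conj_zalg H a (h : gT) : zalg H a -> h \in H -> galg_conj a h = a.
Proof.
by move=> za Hh; apply/ffunP=> x; rewrite galg_conjE za.2 // groupV.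
Qed.

Lemma zalg_conj H a (t : gT) : t \in 'N(H) -> zalg H a -> zalg H (galg_conj a
  t).
Proof.
move=> nHt [sa ca]; split=> [u nHu|h u Hh]; rewrite !galg_conjE.
  by rewrite sa // memJ_norm ?groupV.
by rewrite conjJg [LHS]ca // memJ_norm // groupV.
Qed.

Lemma galg_conj0 (t : gT) : galg_conj (0 : galg F gT) t = 0.
Proof. by rewrite /galg_conj mulr0 mul0r. Qed.

Lemma galg_conj_sum I (r : seq I) (Q : pred I) (f : I -> galg F gT) (t : gT) :
  galg_conj (\sum_(i <- r | Q i) f i) t = \sum_(i <- r | Q i) galg_conj (f i) t.
Proof. by rewrite /galg_conj mulr_sumr mulr_suml. Qed.

Lemma prim_idem_conj H e (t : gT) : t \in 'N(H) -> prim_idem H e ->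
  prim_idem H (galg_conj e t).
Proof.
move=> nHt [ze ee nze pe]; split.
- exact: zalg_conj.
- by rewrite -galg_conjM ee.
- apply: contraNneq nze => et0; rewrite -(galg_conj1 e) -(mulgV t) -galg_conjJ
  et0.
  by rewrite galg_conj0.
move=> g zg gg get; have nHt1: (t^-1)%g \in 'N(H) by rewrite groupV.
have gK : galg_conj (galg_conj g t^-1) t = g by rewrite galg_conjJ mulVg
  galg_conj1.
pose g1 := galg_conj g t^-1.
have g1g1 : g1 * g1 = g1 by rewrite -galg_conjM gg.
have g1e : g1 * e = g1.
  by rewrite -{1}(galg_conj1 e) -(mulgV t) -galg_conjJ -galg_conjM get.
case: (pe _ (zalg_conj nHt1 zg) g1g1 g1e) => [g0|ge].
  by left; rewrite -gK g0 galg_conj0.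
by right; rewrite -gK ge.
Qed.

Lemma prim_idem_orthogonal H e f : prim_idem H e -> prim_idem H f -> e <> f ->
  e * f = 0.
Proof.
move=> [ze ee nze pe] [zf ff nzf pf] nef; have cef := zalg_comm ze zf.1.
have zef := zalgM ze zf.
have efef : e * f * (e * f) = e * f.
  by rewrite mulrA -(mulrA e f e) -cef mulrA ee -mulrA ff.
have efe : e * f * e = e * f by rewrite -mulrA -cef mulrA ee.
have eff : e * f * f = e * f by rewrite -mulrA ff.
case: (pe _ zef efef efe) => // efE; case: (pf _ zef efef eff) => // efF.
by case: nef; rewrite -efE efF.
Qed.

Lemma zalg_rel_trace D a : galg_fixed D a -> zalg G (rel_trace D a).
Proof.
move=> fa; split=> [x|h x _]; first by rewrite inE.
suff Xh : galg_conj (rel_trace D a) h = rel_trace D a.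
  by rewrite -{1}Xh galg_conjE conjgK.
rewrite galg_conj_sum /rel_trace.
rewrite [RHS](reindex_inj (h := fun E : {set gT} => E :* h)) /=; last first.
  by move=> E1 E2 /(congr1 (fun E : {set gT} => E :* h^-1)); rewrite !rcosetK.
apply: eq_big => [E|E /rcosetsP[k _ ->]].
  apply/rcosetsP/rcosetsP=> -[k _ defE].
    by exists (k * h)%g; rewrite ?inE // rcosetM defE.
  by exists (k * h^-1)%g; rewrite ?inE // rcosetM -defE rcosetK.
rewrite -rcosetM [in RHS](galg_conj_rcoset _ fa) -galg_conjJ.
by rewrite (galg_conj_rcoset _ fa).
Qed.

Lemma rel_traceMr D a b : zalg G b -> rel_trace D (a * b) = rel_trace D a * b.
Proof.
move=> zb; rewrite /rel_trace mulr_suml; apply: eq_bigr => E _.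
by rewrite galg_conjM (galg_conj_zalg zb) // inE.
Qed.

(* The last hypothesis makes the index of C(R) in the stabiliser of f0 in N(R)
   prime to p; a rescaled trace X from R then satisfies f0 * Br_R(X) = f0, so
   X * e is invertible in the local algebra e Z(FG). *)
Lemma trace_of_unstable R e f0 : prim_idem G e -> p.-group R -> abelian R ->
    prim_idem 'C(R) f0 -> vanish_off p 'C(R) R f0 -> f0 * res 'C(R) e = f0 ->
    (forall t, t \in 'N(R) -> p.-elt t -> galg_conj f0 t = f0 -> t \in 'C(R)) ->
  exists a, galg_fixed R a /\ rel_trace R a = e.
Proof.
move=> pe pR abR pf vf fe stab; set C := 'C(R)%G; set N := 'N(R)%G.
have [zf ff nzf _] := pf; have [ze ee _ _] := pe.
have sRZ : R \subset 'Z(C).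
  by apply/subsetIP; split=> //; rewrite centsC.
have [a0 [sa0 deff]] := central_trace pF pR sRZ zf vf.
have sCN : C \subset N := cent_sub R.
have nCN t : t \in N -> t \in 'N(C) by apply: (subsetP (cent_norm _)).
pose T := N :&: [set t | galg_conj f0 t == f0].
have TP t : reflect (t \in N /\ galg_conj f0 t = f0) (t \in T).
  apply: (iffP setIP) => -[Nt ft]; split=> //; last by rewrite in_set;
    apply/eqP.
  by apply/eqP; rewrite in_set in ft.
have gT_T : group_set T.
  apply/group_setP; split; first by apply/TP; rewrite group1 galg_conj1.
  move=> s t /TP[Ns fs] /TP[Nt ft]; apply/TP.
  by rewrite groupM // -galg_conjJ fs ft.
pose TG := Group gT_T.
have sTN : TG \subset N by apply/subsetP=> t /TP[].
have sCT : C \subset TG.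
  by apply/subsetP=> c Cc; apply/TP; rewrite (subsetP sCN) // (galg_conj_zalg
    zf).
have nzI : #|TG : C|%:R != 0 :> F.
  rewrite -(dvdn_pcharf pF) -(prime_coprime _ (pcharf_prime pF)).
  have [S sylS] := Sylow_exists p TG; have [sST pS p'S] := and3P sylS.
  have sSC : S \subset C.
    apply/subsetP=> u Su; have /TP[Nu fu] := subsetP sST u Su.
    exact: stab Nu (mem_p_elt pS Su) fu.
  apply: pnat_coprime (pnat_id (pcharf_prime pF)) _.
  exact: pnat_dvd (indexgS _ sSC) p'S.
pose a1 := (#|TG : C|%:R^-1 : F) *: a0.
have sa1 : supp_on C a1 by move=> u nCu; rewrite galg_scaleE sa0 ?mulr0.
have fa1 : galg_fixed R a1.
  move=> r Rr; apply/ffunP=> u; rewrite galg_conjE.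
  have [Cu|nCu] := boolP (u \in C).
    rewrite (conjg_fixP _) //; apply/commgP; apply: commuteV.
    exact: (centP Cu).
  rewrite !sa1 // memJ_norm // groupV; apply: nCN.
  by rewrite (subsetP (normG R)).
have zX := zalg_rel_trace fa1; set X := rel_trace R a1 in zX.
have sRC : R \subset C := abR.
(* R fixes its coset of h exactly when h normalises R, so the Brauer map at R turns the trace to G
   into the trace to N(R). *)
have resX : res C X = ctrace R N a1.
  apply/ffunP=> u; rewrite resE; case: ifPn => [Cu|nCu]; last first.
    rewrite galg_sumE big1 // => E /rcosetsP[h Nh ->].
    have /rcosetP[r Rr ->] := mem_repr_rcoset R h.
    rewrite galg_conjE sa1 // memJ_norm // groupV; apply: nCN.
    by rewrite groupM // (subsetP (normG R)).
  rewrite -[X u]/(ctrace R G a1 u) (ctrace_fix pF fa1 pR (subsetT _) Cu)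
    galg_sumE.
  apply: eq_bigl => E; apply/idP/idP=> [FE|/rcosetsP[h Nh ->]]; last first.
    by rewrite rcoset_fixP ?inE //; have:= groupVr Nh; rewrite inE.
  have /setIP[/rcosetsP[h _ defE] _] := FE; apply/rcosetsP; exists h => //.
  move: FE; rewrite defE rcoset_fixP ?in_setT // => sRh;
    have: (h^-1)%g \in 'N(R) by rewrite inE.
  by rewrite groupV.
(* Tracing through C(R) yields |TG : C|^-1 times the sum of the conjugates of [f0] over N(R) modulo
   C(R). The |TG : C| conjugates by TG equal [f0]; the others are orthogonal to it. *)
have fX : f0 * res C X = f0.
  rewrite resX /ctrace (sum_rcosets (f := galg_conj a1) sRC sCN); last first.
    by move=> r h Rr; rewrite -galg_conjJ fa1.
  pose k : F := #|TG : C|%:R^-1.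
  have inner t : \sum_(E in rcosets R C) galg_conj a1 (repr E * t) = k *:
    galg_conj f0 t.
    rewrite deff galg_conj_sum scaler_sumr; apply: eq_bigr => E _.
    by rewrite -galg_conjJ /a1 /galg_conj -!scalerAr -!scalerAl -!scalerAr
      -!scalerAl.
  rewrite (eq_bigr (fun E : {set gT} => k *: galg_conj f0 (repr E)));
    last by move=> E _; apply: inner.
  rewrite mulr_sumr (bigID (fun E : {set gT} => repr E \in TG)) /= [X in _ +
    X]big1 ?addr0.
    rewrite (eq_bigr (fun=> k *: f0)) => [|E /andP[_]]; last first.
      by case/TP=> _ ->; rewrite -scalerAr ff.
    rewrite sumr_const [#|_|](_ : _ = #|TG : C|).
      by rewrite -scaler_nat scalerA divff // scale1r.
    apply: eq_card => E; apply/andP/rcosetsP.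
      case=> /rcosetsP[h Nh ->]; have /rcosetP[c Cc ->] := mem_repr_rcoset C h.
      move=> TE; exists h => //; have: (c * h)%g \in TG := TE.
      by rewrite groupMl // (subsetP sCT).
    case=> h Th ->; have Nh := subsetP sTN h Th; split;
      first by apply/rcosetsP; exists h.
    have /rcosetP[c Cc ->] := mem_repr_rcoset C h.
    exact: (@groupM _ TG _ _ (subsetP sCT c Cc) Th).
  move=> E /andP[/rcosetsP[h Nh ->]]; have /rcosetP[c Cc ->] := mem_repr_rcoset
    C h.
  have Nch : (c * h)%g \in N by rewrite groupM // (subsetP sCN).
  move=> nT; rewrite -scalerAr (prim_idem_orthogonal pf) ?scaler0 //.
    exact: prim_idem_conj (nCN _ Nch) pf.
  by move=> fE; case/TP: nT.
(* If X^k e = 0, multiplying its Brauer image by [f0] gives f0 = 0. Otherwise the inverse of X on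
   [e] is absorbed into the traced element. *)
have [[k Xk]|[b zb bXe]] := prim_idem_fitting pe zX.
  case/negP: nzf; have := res_centM pR (zalgX k zX) ze; rewrite Xk.
  have -> : res 'C(R) (0 : galg F gT) = 0.
    by apply/ffunP=> u; rewrite resE galg_0E if_same.
  rewrite (res_centX _ pR zX) => /(congr1 (fun y => f0 * y));
    rewrite mulr0 mulrA.
  have -> : f0 * res 'C(R) X ^+ k = f0.
    by elim: (k) => [|i IHi]; rewrite ?mulr1 // exprS mulrA fX.
  by rewrite fe => <-.
have zbe := zalgM zb ze; exists (a1 * (b * e)); split.
  by move=> r Rr; rewrite galg_conjM fa1 // (galg_conj_zalg zbe) // inE.
by rewrite rel_traceMr // -/X mulrA -(zalg_comm zb zX.1).
Qed.

End Stable.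

(** * Numerical estimates *)

Lemma card_center_nonabelian (p : nat) (gT : finGroupType) (P : {group gT}) k :
  prime p -> #|P| = (p ^ k)%N -> ~~ abelian P -> (2 < k)%N /\ (#|'Z(P)| <= p ^
    (k - 2))%N.
Proof.
move=> p_pr cardP nabP; have pP : p.-group P by rewrite /pgroup cardP pnatX
  pnat_id.
have k_gt2 : (2 < k)%N.
  rewrite ltnNge; apply: contra nabP => lek; apply: (p2group_abelian pP).
  by rewrite cardP pfactorK.
split=> //; have [[|[|i]] defI] : {i | #|P : 'Z(P)| = (p ^ i)%N}.
- exact/p_natP/(pnat_dvd (dvdn_indexg _ _)).
- case/negP: nabP; have := indexg_eq1 P 'Z(P); rewrite defI eqxx => /esym sPZ.
  exact: abelianS sPZ (center_abelian P).
- case/negP: nabP; apply: cyclic_center_factor_abelian; apply: prime_cyclic.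
  by rewrite card_quotient ?normal_norm ?center_normal // defI.
have := Lagrange (center_sub P); rewrite defI cardP => defk.
rewrite -(leq_pmul2r (_ : 0 < p ^ 2)%N) ?expn_gt0 ?prime_gt0 // -expnD subnK;
  last exact: ltnW.
by rewrite -defk leq_mul2l leq_pexp2l ?orbT // prime_gt0.
Qed.

(** The left side is p^(d-1) - p^(d-1-j), and excluding j = d - 1 makes the subtracted power at
    least p. *)
Lemma leq_pred_expM p d j : prime p -> (j < d)%N -> j != (d - 1)%N ->
  ((p ^ j).-1 * (p ^ (d - j).-1) <= p ^ (d - 1) - 2)%N.
Proof.
move=> p_pr lt_jd jd; have [i dj] : exists i, (d - j = i.+2)%N by exists (d -
  j).-2; lia.
rewrite dj -subn1 mulnBl mul1n -expnD (_ : j + i.+2.-1 = d - 1)%N; last by lia.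
by rewrite leq_sub2l // expnS (leq_trans (prime_gt1 p_pr)) // leq_pmulr //
  expn_gt0 prime_gt0.
Qed.

(** * The number of factors killing a block idempotent *)

Section Block.

Variables (F : closedFieldType) (p : nat) (gT : finGroupType).
Hypothesis pF : p \in [pchar F].
Implicit Types (a b f n w x y z g : galg F gT) (H R P Q : {group gT})
  (zs : seq (galg F gT)).
Local Notation G := [set: gT]%G.
Variables (e : galg F gT) (D : {group gT}) (d : nat).
Hypotheses (pe : prim_idem G e) (cardD : #|D| = (p ^ d)%N) (nabD : ~~ abelian
  D).
Hypothesis defD : exists a, galg_fixed D a /\ rel_trace D a = e.
Hypothesis minD : forall H, H \subset D ->
  (exists a, galg_fixed H a /\ rel_trace H a = e) -> H :=: D.

Let p_pr := pcharf_prime pF.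
Let p_gt0 := prime_gt0 p_pr.
Let ze : zalg G e. Proof. by case: pe. Qed.
Let ee : e * e = e. Proof. by case: pe. Qed.
Let d_gt2 : (2 < d)%N. Proof. by case: (card_center_nonabelian p_pr cardD
  nabD). Qed.
Let pD : p.-group D. Proof. by rewrite /pgroup cardD pnatX pnat_id. Qed.

Lemma defect_sub P (u : gT) : p.-group P -> u \in 'C(P) -> e u != 0 ->
  exists h, P :^ h \subset D.
Proof.
by move=> pP Cu nzu; have [a [fa ta]] := defD;
  apply: (ctrace_defect pF fa pP Cu); rewrite ta.
Qed.

Lemma defect_card P (u : gT) : p.-group P -> u \in 'C(P) -> e u != 0 ->
  (#|P| <= p ^ d)%N /\ (#|P| = (p ^ d)%N -> ~~ abelian P).
Proof.
move=> pP Cu nzu; have [h sPD] := defect_sub pP Cu nzu.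
rewrite -(cardJg P h) -cardD subset_leq_card //; split=> // cardP.
rewrite -(abelianJ P h) (_ : P :^ h = D) //; apply/eqP.
by rewrite eqEcard sPD cardP leqnn.
Qed.

Lemma cent_vanish_mul P z w : p.-group P -> zalg G z -> zalg G w ->
    (forall u, u \in 'C(P) -> w u = 0) ->
  forall u, u \in 'C(P) -> (z * w) u = 0.
Proof.
move=> pP zz zw w0 u Cu; have /ffunP/(_ u) := res_centM pF pP zz zw.
rewrite resE Cu => ->; rewrite galg_mulE big1 // => v _;
  rewrite [X in _ * X]resE.
by case: ifP => [/w0->|]; rewrite mulr0.
Qed.

Lemma zalg_nilcents zs : nilcents G zs -> zalg G (\prod_(z <- zs) z).
Proof. by move=> zzs; apply: zalg_prod => z /zzs[]. Qed.

Lemma fusion_abelian_sub R zs : R \subset D -> abelian R -> #|R| = (p ^ (d -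
  1))%N ->
    nilcents G zs -> (p ^ (d - 2) <= size zs)%N ->
  forall u, u \in 'C(R) -> (\prod_(z <- zs) z * e) u = 0.
Proof.
move=> sRD abR cardR zzs szs; have pR := pgroupS sRD pD.
set C := 'C(R)%G; have zz := zalg_nilcents zzs.
have zeC : zalg C (res C e) := zalg_res (subsetT _) ze.
have eeC : res C e * res C e = res C e by rewrite -(res_centM pF pR) // ee.
have sRZ : R \subset 'Z(C) by apply/subsetIP; split=> //; rewrite centsC.
(* Were [e] nonzero at [u], the abelian group R<v>, of order at least p^d and centralising [u],
   would contradict [defect_card]. *)
have vC : vanish_off p C R (res C e).
  move=> v u Cv pv nRv /setIP[Cu /cent1P cuv]; rewrite resE Cu.
  apply/eqP/negPn/negP=> nzu; pose P := (R <*> <[v]>)%G.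
  have cRv : <[v]> \subset 'C(R) by rewrite cycle_subG.
  have pP : p.-group P by rewrite /= cent_joinEr // pgroupM pR.
  have CPu : u \in 'C(P).
    by rewrite /= centY inE Cu cent_cycle; apply/cent1P.
  have abP : abelian P by rewrite /= abelianY abR cycle_abelian.
  have [leP nabP] := defect_card pP CPu nzu.
  have ltRP : R \proper P.
    rewrite properE joing_subl; apply: contra nRv => /subsetP; apply.
    by rewrite mem_gen // inE cycle_id orbT.
  have [i defP] := p_natP pP; have := proper_card ltRP.
  rewrite cardR defP ltn_exp2l ?prime_gt1 // => lti.
  suff cP : #|P| = (p ^ d)%N by case/negP: (nabP cP).
  rewrite defP; congr (p ^ _)%N; apply/eqP.
  rewrite eqn_leq -(leq_exp2l i d (prime_gt1 p_pr)) -defP leP /=.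
  by rewrite -(subnK (ltnW (ltnW d_gt2))) addn1.
pose zs' := map (res C) zs.
have zzs' : nilcents C zs'.
  move=> _ /mapP[z /zzs zz1 ->]; rewrite -[C : {set gT}]/('C(R) : {set gT})
    -(setTI 'C(R)).
  exact: (nilcent_res pF pR (subsetT _)).
suff kill : res C e * \prod_(z <- zs') z = 0.
  move=> u Cu; have /ffunP/(_ u) := res_centM pF pR zz ze.
  rewrite resE Cu => ->; rewrite -(setTI 'C(R)) (res_prod pF pR (subsetT _)) =>
    [|z /zzs[]//].
  rewrite setTI -(big_map (res C) xpredT id) -/zs' -(zalg_comm zeC).
    by rewrite kill galg_0E.
  by case: (zalg_prod (fun z zs'z => (zzs' z zs'z).1)).
apply: contrapT => /eqP nz_kill.
have [f [pf fe nzf]] := prim_idem_exists zeC eeC nz_kill.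
have [zf ff nzf0 _] := pf.
have vf : vanish_off p C R f by rewrite -fe; apply: (vanish_offM pF).
(* If there is no such [t], then [trace_of_unstable] makes [e] a trace from R, and minimality gives
   R = D although D is non-abelian. *)
have [t [nRt pt ft nCt]] : exists t, [/\ t \in 'N(R), p.-elt t, galg_conj f t =
  f & t \notin 'C(R)].
  apply: contrapT => not.
  have RD : R :=: D.
    apply: minD => //; apply: (trace_of_unstable pF pe pR abR pf vf fe).
    move=> t nRt pt ft; apply: contrapT => /negP nCt; apply: not.
    by exists t.
  by case/negP: nabD; rewrite -RD.
case/negP: nzf; rewrite (zalg_comm zf); last by case: (zalg_prod (fun z zs'z =>
  (zzs' z zs'z).1)).
apply/eqP; apply: (fusion_kill pF pR sRZ pf vf nRt pt nCt ft).
  move=> z zs'z; split; first exact: zzs'.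
  have /mapP[y /zzs[zy _] ->] := zs'z; apply/ffunP=> u;
    rewrite galg_conjE !resE.
  rewrite memJ_norm ?groupV ?(subsetP (cent_norm _)) // zy.2 // inE //.
rewrite size_map cardR (leq_trans _ szs) //.
by rewrite -(@subnSK 1) ?expnSr ?mulnK // ltnW.
Qed.

Lemma fusion_abelian R zs : p.-group R -> abelian R -> #|R| = (p ^ (d - 1))%N ->
    nilcents G zs -> (p ^ (d - 2) <= size zs)%N ->
  forall u, u \in 'C(R) -> (\prod_(z <- zs) z * e) u = 0.
Proof.
move=> pR abR cardR zzs szs u Cu; have zz := zalg_nilcents zzs.
have [e0|] := pselect (forall v, v \in 'C(R) -> e v = 0);
  first exact: (cent_vanish_mul pR zz ze e0).
case/existsNP=> v /not_implyP[Cv /eqP nzv]; have [h sRD] := defect_sub pR Cv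
  nzv.
have [_ cz] := zalgM zz ze; rewrite -(cz h) ?inE //.
apply: (fusion_abelian_sub (R := (R :^ h)%G)) => //.
- by rewrite abelianJ.
- by rewrite cardJg.
by rewrite /= centJ memJ_conjg.
Qed.

Definition vanish_from k m := forall zs, nilcents G zs -> (m <= size zs)%N ->
  forall P u, p.-group P -> (p ^ k <= #|P|)%N -> u \in 'C(P) ->
  (\prod_(z <- zs) z * e) u = 0.

Lemma nilcents_split m zs : nilcents G zs -> (m <= size zs)%N ->
  exists zs1 zs2, [/\ zs = zs1 ++ zs2, nilcents G zs1, nilcents G zs2,
    size zs2 = m & size zs1 = (size zs - m)%N].
Proof.
move=> zzs szs; pose k := (size zs - m)%N; exists (take k zs), (drop k zs).
rewrite cat_take_drop; split=> //.
- by move=> z /mem_take/zzs.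
- by move=> z /mem_drop/zzs.
- by rewrite size_drop subKn.
by rewrite size_takel // leq_subr.
Qed.

Lemma chain_step P m k zs : p.-group P -> (#|'Z(P)| <= k)%N ->
    (forall ys, nilcents G ys -> (m <= size ys)%N -> forall Q u, p.-group Q ->
      P \proper Q ->
       u \in 'C(Q) -> (\prod_(z <- ys) z * e) u = 0) ->
    nilcents G zs -> (m + k <= size zs)%N ->
  forall u, u \in 'C(P) -> (\prod_(z <- zs) z * e) u = 0.
Proof.
move=> pP leZ vQ zzs szs u Cu.
have [|zs1 [zs2 [defzs zzs1 zzs2 szs2 szs1]]] := nilcents_split zzs (m := m).
  exact: leq_trans (leq_addr _ _) szs.
rewrite defzs big_cat /= -mulrA; apply: (chain_kill pF pP (subsetT _)).
- exact: zalgM (zalg_nilcents zzs2) ze.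
- by move=> Q pQ _ PQ v; rewrite setTI; apply: vQ; rewrite ?szs2.
- exact: zzs1.
- by rewrite (leq_trans leZ) // szs1 leq_subRL // (leq_trans (leq_addr _ _)
  szs).
by rewrite setTI.
Qed.

Lemma vanish_from_step k m : vanish_from k.+1 m -> vanish_from k (m + p ^ k)%N.
Proof.
move=> vk zs zzs szs P u pP leP Cu; have [i cardP] := p_natP pP.
move: leP; rewrite cardP leq_exp2l ?prime_gt1 // leq_eqVlt => /orP[/eqP
  ki|ltki].
  apply: (chain_step pP _ _ zzs szs Cu).
    by rewrite ki -cardP subset_leq_card ?center_sub.
  move=> ys zys sys Q v pQ /proper_card; rewrite cardP => ltPQ.
  have [j cardQ] := p_natP pQ; apply: vk => //.
  by move: ltPQ; rewrite cardQ ltn_exp2l ?prime_gt1 // leq_exp2l ?prime_gt1 //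
    ki.
apply: (vk zs zzs _ P) => //; first exact: leq_trans (leq_addr _ _) szs.
by rewrite cardP leq_exp2l ?prime_gt1.
Qed.

Lemma vanish_from_top : vanish_from (d - 1) (p ^ (d - 2) + p ^ (d - 3)).
Proof.
have top zs P u : nilcents G zs -> (p ^ (d - 2) <= size zs)%N -> p.-group P ->
    (p ^ d <= #|P|)%N -> u \in 'C(P) -> (\prod_(z <- zs) z * e) u = 0.
  move=> zzs szs pP leP Cu; have zz := zalg_nilcents zzs.
  have [e0|] := pselect (forall v, v \in 'C(P) -> e v = 0);
    first exact: (cent_vanish_mul pP zz ze e0).
  case/existsNP=> v /not_implyP[Cv /eqP nzv];
    have [geP nabP] := defect_card pP Cv nzv.
  have cardP : #|P| = (p ^ d)%N by apply/eqP; rewrite eqn_leq geP.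
  have [_ leZ] := card_center_nonabelian p_pr cardP (nabP cardP).
  apply: (chain_step pP leZ _ zzs (m := 0%N) szs Cu).
  move=> ys zys _ Q w pQ /proper_card ltPQ Cw;
    apply: (cent_vanish_mul pQ (zalg_nilcents zys) ze _ Cw).
  move=> w1 Cw1; apply/eqP/negPn/negP=> nzw; have [leQ _] := defect_card pQ Cw1
    nzw.
  by move: ltPQ; rewrite cardP ltnNge leQ.
move=> zs zzs szs P u pP leP Cu; have szs1 := leq_trans (leq_addr _ _) szs.
have [i cardP] := p_natP pP.
have [ledi|ltid] := leqP d i.
  by apply: top Cu; rewrite // cardP leq_exp2l ?prime_gt1.
have def_i : i = (d - 1)%N.
  apply/eqP; rewrite eqn_leq -(leq_exp2l (d - 1) i (prime_gt1 p_pr)) -cardP leP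
    andbT.
  by rewrite -ltnS subn1 prednK // (ltn_trans _ d_gt2).
have [abP|nabP] := boolP (abelian P).
  by apply: (fusion_abelian pP abP _ zzs szs1 Cu); rewrite cardP def_i.
have [i_gt2 leZ] := card_center_nonabelian p_pr cardP nabP.
apply: (chain_step pP _ _ zzs szs Cu).
  by rewrite (leq_trans leZ) // def_i -subnDA.
move=> ys zys sys Q v pQ /proper_card ltPQ; apply: top => //.
have [j cardQ] := p_natP pQ; move: ltPQ; rewrite cardP cardQ ltn_exp2l
  ?prime_gt1 //.
by rewrite leq_exp2l ?prime_gt1 // def_i subn1 prednK // (ltn_trans _ d_gt2).
Qed.

Lemma vanish_from_bottom k m : vanish_from k m -> vanish_from 0 (m + \sum_(i <
  k) p ^ i)%N.
Proof.
elim: k m => [|k IHk] m vk; first by rewrite big_ord0 addn0.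
by rewrite big_ord_recr /= [X in (m + X)%N]addnC addnA;
  apply/IHk/vanish_from_step.
Qed.

Lemma kill_odd zs : (2 < p)%N -> nilcents G zs -> (3 * p ^ (d - 2) <= (size
  zs).+1)%N ->
  \prod_(z <- zs) z * e = 0.
Proof.
move=> p_gt2 zzs szs; apply/ffunP=> u; rewrite galg_0E.
have vb := vanish_from_bottom vanish_from_top; apply: (vb zs zzs _ 1%G u) => //.
- rewrite -ltnS (leq_trans _ szs) //.
  have [k dk] : exists k, d = k.+3 by exists (d - 3)%N; rewrite -addn3 subnK.
  rewrite dk !subSS !subn0 /=.
  (* For p >= 3 the geometric sum up to p^(d-2) is below (3/2) p^(d-2), and p^(d-3) is at most a
     third of p^(d-2). The total is thus below (1 + 1/3 + 3/2) p^(d-2), less than 3 p^(d-2). *)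
  have le_sum i : (2 * \sum_(j < i.+1) p ^ j <= (3 * p ^ i).-1)%N.
    elim: i => [|i IHi]; first by rewrite big_ord1 expn0.
    rewrite big_ord_recr /= mulnDr -ltnS prednK ?muln_gt0 ?expn_gt0 ?p_gt0 //.
    have:= IHi; rewrite -ltnS prednK ?muln_gt0 ?expn_gt0 ?p_gt0 // => IH'.
    rewrite -addSn (mulnDl 1 2) mul1n leq_add2r (leq_trans IH') //.
    by rewrite expnS leq_mul2r p_gt2 orbT.
  have := le_sum k.+1; rewrite -ltnS prednK ?muln_gt0 ?expn_gt0 ?p_gt0 // => Hs.
  have : (3 * p ^ k <= p ^ k.+1)%N by rewrite expnS leq_mul2r p_gt2 orbT.
  have : (0 < p ^ k)%N by rewrite expn_gt0 p_gt0.
  move: Hs; set S := (\sum_(j < k.+2) p ^ j)%N.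
  move: (p ^ k)%N (p ^ k.+1)%N S => X Y S; lia.
- exact: pgroup1.
- by rewrite cards1.
by rewrite cent1T inE.
Qed.

(** One of the p^(d-1) - 1 factors annihilates the section-constant function that the others
    produce. At an element of order p^j these suffice by [leq_pred_expM] if j < d - 1, and for j >=
    d the image of [e] is zero. For j = d - 1 one factor is lacking, and fusion on the abelian group
    <u> takes over. *)
Lemma kill_even zs : nilcents G zs -> ((p ^ (d - 2)).+2 <= p ^ (d - 1))%N ->
  (p ^ (d - 1) <= (size zs).+1)%N -> \prod_(z <- zs) z * e = 0.
Proof.
move=> zzs lt_p szs; have sz_gt0 : (0 < size zs)%N.
  by rewrite -ltnS (leq_trans _ szs) // (leq_trans _ lt_p) // !ltnS.
case: zs zzs sz_gt0 szs => // z zs zzs _ /= szs.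
have zzs' : nilcents G zs by move=> y sy; apply: zzs; rewrite inE sy orbT.
have zW := zalgM (zalg_nilcents zzs') ze.
rewrite big_cons -mulrA; apply: (nilcent_mul_sect_const pF (zzs z (mem_head _
  _)) zW) => u x Gu pu Cx.
have Cx' : x \in 'C(<[u]>) by case/setIP: Cx; rewrite cent_cycle.
have sz1 : (p ^ (d - 1) - 2 <= size zs)%N by rewrite leq_subLR add2n.
have [j cardU] : {j | #|<[u]>| = (p ^ j)%N} by apply/p_natP.
have [jd|jd] := eqVneq j (d - 1)%N.
  have van v : v \in 'C(<[u]>) -> (\prod_(z <- zs) z * e) v = 0.
    apply: (fusion_abelian (R := <[u]>%G)) => //; rewrite ?cycle_abelian //.
      by rewrite cardU jd.
    by apply: leq_trans sz1; move: (p ^ (d - 2))%N (p ^ (d - 1))%N lt_p => X Y;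
      lia.
  have Cu : u \in 'C(<[u]>) by rewrite cent_cycle cent1id.
  by rewrite !van // groupM.
have s1Z : [1 gT] \subset 'Z(G) by apply: sub1G.
have dG : nonabelian_defect p d G 1%G e.
  move=> P v pP _; rewrite setTI cards1 mul1n => Cv nzv;
    exact: defect_card Cv nzv.
have joinU : [1 gT] <*> <[u]> = <[u]> by rewrite joing1G.
have Nj : #|[1 gT] <*> <[u]> : [1 gT]| = (p ^ j)%N by rewrite joinU indexg1
  cardU.
have [dC pU sUZ e0] := nonabelian_defect_cent pF (pgroup1 gT p) s1Z Gu pu Nj dG.
pose n := if (d <= j)%N then 0%N else (p ^ (d - j).-1)%N.
have sUG : <[u]> \subset G := subsetT _.
have := sect_const_step pF (n := n) (R := 1%G) (pgroup1 gT p) s1Z ze ee zzs' Gu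
  pu.
rewrite sumg1 mulr1; apply=> // [ys zys|].
  rewrite /n; case: ifP => [/e0-> _|/negbT]; first by rewrite mulr0 mul0r.
  rewrite -ltnNge => ltjd sys; case: dC => [dC|->]; last by rewrite mulr0 mul0r.
  apply: (nonabelian_kill pF (H := 'C_G[u]%G) (R := ([1 gT] <*> <[u]>)%G) pU
    sUZ _ _ dC) => //.
    exact: zalg_res (subsetT _) ze.
  by have := resM pF pu sUG ze ze; rewrite cent_cycle ee => <-.
rewrite /= Nj /n; case: ifP => [_|/negbT]; first by rewrite muln0.
rewrite -ltnNge => ltjd; apply: leq_trans sz1.
exact: leq_pred_expM.
Qed.

End Block.

(** * Blocks as primitive central idempotents *)

Section Glue.

Variables (F : closedFieldType) (gT : finGroupType).
Implicit Types (a b e f n w x y z g : galg F gT).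
Local Notation G := [set: gT]%G.
Variable (B : {aspace galg F gT}).
Hypothesis blockB : is_block B.
Let e := algid B.

Lemma zalg_setT a : (forall x, a * x = x * a) -> zalg G a.
Proof.
move=> ca; split=> [u|h u _]; first by rewrite inE.
have /ffunP/(_ (u * h)%g) := ca (gelt F h).
by rewrite mul_geltE mulgK gelt_mulE => ->; rewrite conjgE.
Qed.

Lemma block_mul a b : b \in B -> a * b \in B /\ b * a \in B.
Proof.
case: blockB => /andP[lB rB] _ _ Bb; split.
  by apply: (subvP lB); rewrite memv_mul ?memvf.
by apply: (subvP rB); rewrite memv_mul ?memvf.
Qed.

Lemma algid_central a : e * a = a * e.
Proof.
have [ae ea] := block_mul a (memv_algid B).
by rewrite -[LHS](algidr ea) -[RHS](algidl ae) mulrA.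
Qed.

(** A central idempotent g with g e = g splits B into the ideals FG g and FG (e - g), one of which
    is zero. *)
Lemma block_prim_idem : prim_idem G e.
Proof.
have ee : e * e = e := algidl (memv_algid B).
split; first exact: zalg_setT algid_central.
- exact: ee.
- exact: algid_neq0.
move=> g zg gg ge; have cg a : g * a = a * g.
  by apply: (zalg_comm zg) => u; rewrite inE.
have ideal h : (forall a, h * a = a * h) -> two_sided_ideal (limg (amulr h)).
  move=> ch; apply/andP; split; apply/prodvP=> a b.
    move=> _ /memv_imgP[c _ ->]; apply/memv_imgP; exists (a * c);
      rewrite ?memvf //.
    by rewrite !lfunE /= mulrA.
  move=> /memv_imgP[c _ ->] _; apply/memv_imgP; exists (c * b);
    rewrite ?memvf //.
  by rewrite !lfunE /= -!mulrA ch.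
have ceg a : (e - g) * a = a * (e - g) by rewrite mulrBl mulrBr algid_central
  cg.
have [_ _ indec] := blockB.
case: (indec _ _ (ideal g cg) (ideal _ ceg)).
- apply/eqP; rewrite eqEsubv; apply/andP; split.
    rewrite subv_add; apply/andP; split; apply/subvP=> _ /memv_imgP[c _ ->].
      rewrite lfunE /= -ge mulrA; exact: (block_mul _ (memv_algid B)).1.
    rewrite lfunE /= -{1}ee -ge -mulrBl mulrA;
      exact: (block_mul _ (memv_algid B)).1.
  apply/subvP=> b Bb; apply/memv_addP; exists (b * g).
    by apply/memv_imgP; exists b; rewrite ?memvf // lfunE.
  exists (b * (e - g)); first by apply/memv_imgP; exists b;
    rewrite ?memvf // lfunE.
  by rewrite -mulrDr addrCA subrr addr0 (algidr Bb).
- apply/eqP; rewrite -subv0; apply/subvP=> y /memv_capP[/memv_imgP[c _ ->]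
  /memv_imgP[b _]].
  rewrite memv0 !lfunE /= => defc; rewrite -gg mulrA defc -mulrA mulrBl gg.
  by rewrite algid_central ge subrr mulr0.
- move=> U0; left; apply/eqP; rewrite -memv0 -U0; apply/memv_imgP; exists 1.
    exact: memvf.
  by rewrite lfunE /= mul1r.
move=> V0; right; apply/esym/eqP; rewrite -subr_eq0 -memv0 -V0; apply/memv_imgP.
by exists 1; rewrite ?memvf // lfunE /= mul1r.
Qed.

End Glue.

(** * Loewy length of the centre *)

Section Loewy.

Variables (F : fieldType) (A : falgType F).
Implicit Types (x y b : A).

Lemma expv_mul_eq0 (J : {vspace A}) n b :
    (forall xs, size xs = n -> (forall x, x \in xs -> x \in J) ->
       \prod_(x <- xs) x * b = 0) ->
  forall y, y \in (J ^+ n)%VS -> y * b = 0.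
Proof.
elim: n b => [|n IHn] b kill y.
  have b0 : b = 0 by have := kill [::]; rewrite big_nil mul1r; apply.
  by rewrite b0 mulr0.
rewrite expvSr => Jy; apply/eqP; rewrite -memv0.
suff: (J ^+ n * J <= lker (amulr b))%VS.
  by move/subvP/(_ y Jy); rewrite memv_ker lfunE /= memv0.
apply/prodvP=> u v Ju Jv; rewrite memv_ker lfunE /= -mulrA; apply/eqP.
apply: IHn Ju => xs sxs Jxs; have := kill (rcons xs v).
rewrite -cats1 big_cat big_seq1 mulrA; apply.
  by rewrite size_cat sxs addn1.
by move=> w; rewrite mem_cat inE => /orP[/Jxs|/eqP->].
Qed.

Lemma memvX (J : {vspace A}) x n : x \in J -> x ^+ n \in (J ^+ n)%VS.
Proof.
move=> Jx; elim: n => [|n IHn]; first by rewrite expv0 memv_line.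
by rewrite expvSl exprS memv_mul.
Qed.

Lemma loewy_length_le n :
    (forall xs : seq A, size xs = n -> (forall x, x \in xs -> exists k, x ^+ k
      = 0) ->
       \prod_(x <- xs) x = 0) ->
  (loewy_length A <= n)%N.
Proof.
move=> kill; rewrite /loewy_length; case: ex_minnP => m _; apply.
rewrite -subv0; apply/subvP=> y Jy; rewrite memv0 -[y]mulr1; apply/eqP.
apply: expv_mul_eq0 Jy => xs sxs Jxs; rewrite mulr1;
  apply: kill => // x /Jxs Jx.
have [k /eqP Jk] := jacobson_nilpotent A; exists k; apply/eqP.
by rewrite -memv0 -Jk memvX.
Qed.

End Loewy.

Lemma block_center_nilcent (F : closedFieldType) (gT : finGroupType) (B :
  {aspace galg F gT})
    (x : subvs_of 'Z(B)%AS) k :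
  is_block B -> x ^+ k = 0 -> nilcent [set: gT]%G (vsval x).
Proof.
move=> bB xk; have [Bx /centvP cx] := memv_capP (subvsP x).
(* The unit of the centre is [algid B] and not 1, whence the factor [algid B] here and the exponent
   k + 1 below. *)
have valX i : vsval x ^+ i * algid B = vsval (x ^+ i).
  elim: i => [|i IHi]; first by rewrite mul1r -[algid B]algid_center.
  by rewrite exprS -mulrA IHi exprS.
split; last first.
  exists k.+1; rewrite exprSr -[vsval x in X in _ * X](algidl Bx) mulrA valX xk.
  by rewrite mul0r.
apply: zalg_setT => a; have [Bae Bea] := block_mul bB a (memv_algid B).
rewrite -{1}(algidr Bx) -mulrA cx // (algid_central bB) -mulrA.
by rewrite (algidl Bx).
Qed.

Lemma loewy_center_lt (gT : finGroupType) (F : closedFieldType) (p d : nat)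
    (B : {aspace galg F gT}) (D : {group gT}) :
  p \in [pchar F] -> is_block B -> is_defect_group B D -> ~~ abelian D ->
  #|D| = (p ^ d)%N ->
  (loewy_length (subvs_of 'Z(B)%AS) < minn (p ^ (d - 1)) (3 * p ^ (d - 2)))%N.
Proof.
move=> pF bB [[a fa ta] minD] nabD cardD; set LLZB := loewy_length _.
have p_pr := pcharf_prime pF.
have [d_gt2 _] := card_center_nonabelian p_pr cardD nabD.
have pe := block_prim_idem bB.
have defD : exists a, galg_fixed D a /\ rel_trace D a = algid B by exists a.
have min (H : {group gT}) : H \subset D ->
    (exists a, galg_fixed H a /\ rel_trace H a = algid B) -> H :=: D.
  by move=> sHD [b [fb tb]]; apply: minD => //; exists b.
have bound N : (forall zs, nilcents [set: gT]%G zs -> size zs = N ->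
    \prod_(z <- zs) z * algid B = 0) -> (LLZB <= N)%N.
  move=> kill; apply: loewy_length_le => xs sxs nxs; apply/val_inj.
  have -> : val (\prod_(x <- xs) x) = \prod_(z <- map vsval xs) z * algid B.
    elim: (xs) => [|x s IHs]; first by rewrite !big_nil mul1r -[algid
      B]algid_center.
    by rewrite /= !big_cons -mulrA -IHs.
  rewrite kill ?size_map // => _ /mapP[x xsx ->].
  by have [k xk] := nxs x xsx; apply: block_center_nilcent bB xk.
have [k dk] : exists k, d = k.+3 by exists (d - 3)%N; rewrite -addn3 subnK.
have pd : (p ^ (d - 1) = p * p ^ (d - 2))%N by rewrite dk !subSS !subn0 expnS.
have X0 : (0 < p ^ (d - 2))%N by rewrite expn_gt0 prime_gt0.
(* The minimum is p^(d-1) = 2 p^(d-2) for p = 2 and 3 p^(d-2) for p >= 3. *)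
have [p2|p_gt2] : p = 2%N \/ (2 < p)%N.
  by have := prime_gt1 p_pr; rewrite leq_eqVlt => /orP[/eqP|]; [left | right].
- have LL : (LLZB <= (p ^ (d - 1)).-1)%N.
    apply: bound => zs zzs szs; apply: (kill_even pF pe cardD nabD defD min
      zzs).
      have : (2 <= p ^ (d - 2))%N by rewrite dk !subSS !subn0 p2 expnS
        leq_pmulr ?expn_gt0.
      by rewrite pd p2; move: (2 ^ (d - 2))%N => X; lia.
    by rewrite szs; lia.
  by move: LL X0; rewrite leq_min pd p2; move: (2 ^ (d - 2))%N (LLZB) => X L;
    lia.
have LL : (LLZB <= (3 * p ^ (d - 2)).-1)%N.
  apply: bound => zs zzs szs; apply: (kill_odd pF pe cardD nabD defD min p_gt2
    zzs).
  by rewrite szs; lia.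
rewrite leq_min pd; move: LL X0; move: (p ^ (d - 2))%N (LLZB) => X L; nia.
Qed.

Close Scope ring_scope.
Close Scope group_scope.

Theorem theorem3 (gT : finGroupType) (F : closedFieldType) (p d : nat)
    (B : {aspace galg F gT}) (D : {group gT}) :
  p \in [pchar F]%R ->
  is_block B ->
  is_defect_group B D ->
  ~~ abelian D ->
  #|D| = p ^ d ->
  let LLZB := loewy_length (subvs_of 'Z(B)%AS) in
  ((LLZB < 3 * p ^ (d - 2))%N \/
   [/\ (5 <= p)%N, isog_W D p d & (LLZB < 4 * p ^ (d - 2))%N]) /\
  (LLZB < minn (p ^ (d - 1)) (4 * p ^ (d - 2)))%N.
Proof.
move=> pF bB dD nabD cardD LLZB.
have := loewy_center_lt pF bB dD nabD cardD; rewrite -/LLZB !leq_min.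
case/andP=> lt1 lt3; split; first by left.
by rewrite lt1 (leq_trans lt3) // leq_mul2r orbT.
Qed.
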